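(* Consider the mean-shift model $y=X\beta^\star+\mu^\star+\varepsilon$ with $X\in\mathbb{R}^{n\times p}$ deterministic with columns of unit Euclidean norm, $\beta^\star\in\mathbb{R}^p$ arbitrary, $\mu^\star\in\mathbb{R}^n$ with $|\mu^\star|_0\le s$ for a positive integer $s$, and $\varepsilon\sim\mathcal N(0,\sigma^2 I_n)$. Let $\lambda_i=\sigma\sqrt{\log(2n/i)}$, $i=1,\dots,n$, let $\rho\ge 2(4+\sqrt2)$, and let $$(\hat\beta,\hat\mu)\in\arg\min_{\beta\in\mathbb{R}^p,\mu\in\mathbb{R}^n}\Big\{\|y-X\beta-\mu\|_2^2+2\rho J_\lambda(\mu)\Big\}.$$ Let $k_1=p/\log 2$ and $s_1=s\log(2en/s)/\log2$, and suppose there are constants $\kappa_1>2\kappa_2>0$ such that for all $(\beta,\mu)\in\mathbb{R}^p\times\mathbb{R}^n$ satisfying $\sum_{j=1}^n\frac{\lambda_j}{\lambda_n}|\mu|_{(j)}\le 5\big(\sqrt{k_1}\|\beta\|_2+\sqrt{s_1}\|\mu\|_2\big)$ one has $$\|X\beta\|_2^2+\|\mu\|_2^2\ge\kappa_1(\|\beta\|_2^2+\|\mu\|_2^2),\qquad |\langle X\beta,\mu\rangle|\le\kappa_2(\|\beta\|_2^2+\|\mu\|_2^2).$$ Let $\kappa=\sqrt{\kappa_1-2\kappa_2}$. Then, with probability at least $1-\frac12(s/2n)^s-e^{-p}$, $$\|\hat\beta-\beta^\star\|_2^2+\|\hat\mu-\mu^\star\|_2^2\le\frac{4\rho^2}{\kappa^4}\sum_{j=1}^s\lambda_j^2+\frac{5\sigma^2}{\kappa^4}p\le\frac{\sigma^2}{\kappa^4}\Big(4\rho^2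 s\log\Big(\frac{2en}{s}\Big)+5p\Big).$$
   Context: For $u\in\mathbb{R}^m$, $|u|_0$ is the number of nonzero entries of $u$, and $|u|_{(1)}\ge\dots\ge|u|_{(m)}$ are the absolute values of its entries sorted in non-increasing order. For a vector $\lambda\in\mathbb{R}^m$ with non-negative non-increasing entries, the sorted-$\ell_1$ norm is $J_\lambda(x)=\sum_{j=1}^m\lambda_j|x|_{(j)}$. *)

(* Defs.v *)
From HB Require Import structures.
From mathcomp Require Import all_boot all_order all_algebra.
From mathcomp Require Import all_classical all_reals all_analysis.
Set Implicit Arguments. Unset Strict Implicit. Unset Printing Implicit Defensive.
Import Order.TTheory GRing.Theory Num.Theory.
Local Open Scope classical_set_scope.
Local Open Scope ring_scope.

Definition sqnorm {R : realType} {m : nat} (v : 'cV[R]_m) : R :=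
  \sum_(i < m) v i 0 ^+ 2.

Definition dotv {R : realType} {m : nat} (u v : 'cV[R]_m) : R :=
  \sum_(i < m) u i 0 * v i 0.

Definition l0 {R : realType} {m : nat} (u : 'cV[R]_m) : nat :=
  #|[set i : 'I_m | u i 0 != 0]|.

(* |u|_(1) >= ... >= |u|_(m) : absolute values sorted non-increasingly;
   sorted_abs u j (j : 'I_m, 0-based) is |u|_(j+1). *)
Definition sorted_abs {R : realType} {m : nat} (u : 'cV[R]_m) (j : nat) : R :=
  nth 0 (sort (fun a b : R => b <= a) [seq `|u i 0| | i <- enum 'I_m]) j.

(* Sorted-l1 norm J_lambda(u) = \sum_{j=1}^m lambda_j |u|_(j);
   lam j (j : 'I_m, 0-based) stands for lambda_{j+1}. *)
Definition Jsl {R : realType} {m : nat} (lam : 'I_m -> R) (u : 'cV[R]_m) : R :=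
  \sum_(j < m) lam j * sorted_abs u j.

(* The tuning sequence lambda_i = sigma sqrt(log(2n/i)), 1-based index i. *)
Definition lam_seq {R : realType} (sigma : R) (n i : nat) : R :=
  sigma * Num.sqrt (ln (2 * n%:R / i%:R)).

Definition objective {R : realType} {n p : nat} (X : 'M[R]_(n, p)) (y : 'cV[R]_n)
  (rho : R) (lam : 'I_n -> R) (b : 'cV[R]_p) (m : 'cV[R]_n) : R :=
  sqnorm (y - X *m b - m) + 2 * rho * Jsl lam m.

Definition is_argmin {R : realType} {n p : nat} (X : 'M[R]_(n, p)) (y : 'cV[R]_n)
  (rho : R) (lam : 'I_n -> R) (bh : 'cV[R]_p) (mh : 'cV[R]_n) : Prop :=
  forall (b : 'cV[R]_p) (m : 'cV[R]_n),
    objective X y rho lam bh mh <= objective X y rho lam b m.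

(* eps = (eps_1,...,eps_n) ~ N(0, sigma^2 I_n): each coordinate measurable,
   mutually independent, each N(0, sigma^2)
   (normal_prob m s has mean m and standard deviation s). *)
Definition gaussian_noise {d : measure_display} {Omega : measurableType d}
  {R : realType} (P : probability Omega R) (n : nat) (sigma : R)
  (eps : 'I_n -> Omega -> R) : Prop :=
  [/\ (forall i, measurable_fun setT (eps i)),
      (forall i (A : set R), measurable A ->
          P (eps i @^-1` A) = normal_prob 0 sigma A) &
      (forall (I : {set 'I_n}) (A : 'I_n -> set R), (forall i, measurable (A i)) ->
          P (\bigcap_(i in [set j | j \in I]) (eps i @^-1` A i)) =
          (\prod_(i in I) P (eps i @^-1` A i))%E)].

Definition noise_vec {d : measure_display} {Omega : measurableType d}
  {R : realType} (n : nat) (eps : 'I_n -> Omega -> R) (w : Omega) : 'cV[R]_n :=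
  \col_(i < n) eps i w.

(* Main.v *)
Require Import Defs.
From HB Require Import structures.
From mathcomp Require Import all_boot all_order all_algebra.
From mathcomp Require Import all_classical all_reals all_analysis.
From mathcomp Require Import measurable_realfun zify ring lra.
Import Order.TTheory GRing.Theory Num.Theory.
Local Open Scope classical_set_scope.
Local Open Scope ring_scope.
Set Implicit Arguments. Unset Strict Implicit. Unset Printing Implicit Defensive.

(** Write [b] and [m] for the errors on [beta] and [mu], [M = |m|], [a = |X b|],
    [Lam^2 = \sum_(j <= s) lambda_j^2] and [q = sigma sqrt(5 p)].  Two events carry the
    probability: [|<eps, X b>| <= q a] for all [b], a chi-square bound for the projection of the
    noise on the column space of [X]; and [\sum_(i in S) eps_i^2 <= 24 sigma^2 |S| log(2n/|S|)]
    for all [S] with [|S| >= s], by a union bound.  By summation by parts the second event gives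
    [<eps, m> <= (rho/2) (Lam M + J(m))].

    Convexity along the segment to the truth yields
    [|X b + m|^2 <= <eps, X b + m> + rho (J(mu) - J(mu + m))], and sparsity of [mu] bounds the last
    difference by head minus tail of [J(m)].  Stationarity in the direction [b] turns this into
    [J(m) <= 5 Lam M + (2/rho) q M], which does not put [(b, m)] in the cone but puts there every
    [(b', m)] with [|b'| = M]; rescaling gives [|<X b, m>| <= kappa2 (|b|^2 + M^2)].  The cone with
    [m = 0] gives [a^2 >= kappa1 |b|^2], and with [m] a basis vector it gives [kappa1 <= 1]. *)

(** * Expectations of products of independent Gaussian functionals *)

Section layer_cake.
Context d (T : measurableType d) (R : realType).
Variable m : {sigma_finite_measure set T -> \bar R}.
Let mu : {sigma_finite_measure set (measurableTypeR R) -> \bar R} := @lebesgue_measure R.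

Lemma integral_indic_below (r : R) : 0 <= r ->
  (\int[mu]_y (\1_`[0, r[ y)%:E = r%:E)%E.
Proof.
move=> r0; rewrite integral_indic//= setIT /mu lebesgue_measure_itv/= lte_fin.
by case: ltgtP r0 => // [_ _|<- //]; rewrite EFinN sube0.
Qed.

(** [f x] is the length of [[0, f x[], and Tonelli exchanges the two integrals. With the weight [G],
    an identity known for indicators of level sets extends to nonnegative measurable functions. *)
Lemma layer_cake (G f : T -> R) : (forall x, 0 <= G x) -> (forall x, 0 <= f x) ->
  measurable_fun setT G -> measurable_fun setT f ->
  (\int[m]_x (G x * f x)%:E =
   \int[mu]_y \int[m]_x (G x * \1_(f @^-1` [set z | (0 <= y < z)%R]) x)%:E)%E.
Proof.
move=> G0 f0 mG mf.
transitivity (\int[m]_x \int[mu]_y (G x * \1_`[0, f x[ y)%:E)%E.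
  apply: eq_integral => x _.
  under eq_integral do rewrite EFinM.
  rewrite ge0_integralZl ?lee_fin//; first by rewrite integral_indic_below// EFinM.
  by apply/measurable_EFinP/measurable_indic.
rewrite (fubini_tonelli (fun q : T * measurableTypeR R =>
  (G q.1 * \1_`[0, f q.1[ q.2)%:E)%E) /=.
- by apply: eq_integral => y _; apply: eq_integral => x _; congr ((_ * _)%:E).
- apply/measurable_EFinP/measurable_funM.
    exact: measurableT_comp.
  apply/measurable_indic => /=.
  rewrite [X in measurable X](_ : _ =
      (fun q : T * measurableTypeR R => 0 <= q.2) @^-1` [set true] `&`
      (fun q : T * measurableTypeR R => q.2 < f q.1) @^-1` [set true]); last first.
    by apply/seteqP; split => q; rewrite /= in_itv/= => /andP.
  apply: measurableI.
  - have : measurable_fun setT (fun q : T * measurableTypeR R => 0 <= q.2).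
      exact: measurable_fun_ler.
    by move=> /(_ measurableT [set true]); rewrite setTI; exact.
  - have : measurable_fun setT (fun q : T * measurableTypeR R => q.2 < f q.1).
      apply: measurable_fun_ltr => //; exact: measurableT_comp.
    by move=> /(_ measurableT [set true]); rewrite setTI; exact.
- by move=> q; rewrite lee_fin mulr_ge0.
Qed.
End layer_cake.

Lemma measurable_above (R : realType) (y : R) : measurable [set z : R | 0 <= y < z].
Proof.
have [y0|y0] := leP 0 y.
  rewrite (_ : [set _ | _] = `]y, +oo[%classic)//.
  by apply/seteqP; split => z /=; rewrite in_itv/= andbT.
rewrite (_ : [set _ | _] = set0)//.
by apply/seteqP; split => z /=.
Qed.

Lemma integral_mul_indic (R : realType) (h : R -> R) (A : set R) :
  (\int[lebesgue_measure]_x (h x * \1_A x)%:E =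
   \int[lebesgue_measure]_(x in A) (h x)%:E)%E.
Proof.
rewrite [RHS]integral_mkcond; apply: eq_integral => x _.
by rewrite patchE indicE; case: ifPn => _; rewrite ?mulr1 ?mulr0.
Qed.

(** Both sides are expanded by [layer_cake]; at each level [y] the integrands agree by the
    hypothesis on indicators. *)
Lemma integral_density_comp d (T : measurableType d) (R : realType)
    (m : {sigma_finite_measure set T -> \bar R}) (Y G : T -> R) (h f : R -> R) :
  measurable_fun setT Y -> measurable_fun setT G -> (forall w, 0 <= G w) ->
  measurable_fun setT h -> (forall x, 0 <= h x) ->
  measurable_fun setT f -> (forall x, 0 <= f x) ->
  (forall A, measurable A -> \int[m]_w (G w * \1_A (Y w))%:E =
     \int[lebesgue_measure]_(x in A) (h x)%:E)%E ->
  (\int[m]_w (G w * f (Y w))%:E = \int[lebesgue_measure]_x (h x * f x)%:E)%E.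
Proof.
move=> mY mG G0 mh h0 mf f0 GA.
pose mu : {sigma_finite_measure set (measurableTypeR R) -> \bar R} := @lebesgue_measure R.
rewrite (layer_cake m (f := f \o Y))//; [|by move=> w; exact: f0|exact: measurableT_comp].
rewrite (layer_cake mu)//; apply: eq_integral => y _.
rewrite integral_mul_indic -GA//.
by rewrite -[X in measurable X]setTI; apply: mf => //; exact: measurable_above.
Qed.

Section independent.
Context d (Omega : measurableType d) (R : realType) (P : probability Omega R).
Variables (n : nat) (sigma : R) (eps : 'I_n -> Omega -> R).
Hypothesis Heps : gaussian_noise P sigma eps.

(** Induction on the number [k] of leading coordinates whose factor is arbitrary, the others being
    indicators. For [k = 0] this is independence applied to sets. Each step frees one coordinate by
    [integral_density_comp]. *)
Lemma integral_prod_gaussian (g : 'I_n -> R -> R) (c : 'I_n -> R) :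
  (forall i, measurable_fun setT (g i)) -> (forall i x, 0 <= g i x) ->
  (forall i, \int[lebesgue_measure]_x (normal_pdf 0 sigma x * g i x)%:E = (c i)%:E)%E ->
  (\int[P]_w (\prod_i g i (eps i w))%:E = (\prod_i c i)%:E)%E.
Proof.
have [meps law indep] := Heps.
move=> mg g0 gc.
suff /(_ n g c) : forall k (g : 'I_n -> R -> R) (c : 'I_n -> R),
  (forall i, measurable_fun setT (g i)) -> (forall i x, 0 <= g i x) ->
  (forall i, \int[lebesgue_measure]_x (normal_pdf 0 sigma x * g i x)%:E = (c i)%:E)%E ->
  (forall i : 'I_n, (k <= i)%N -> exists2 A, measurable A & g i = \1_A) ->
  (\int[P]_w (\prod_i g i (eps i w))%:E = (\prod_i c i)%:E)%E.
  by apply => // i; rewrite leqNgt ltn_ord.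
move=> {mg g0 gc g c} k; elim: k => [|k IHk] g c mg g0 gc gA.
  have /choice[A mA] : forall i : 'I_n, exists A, measurable A /\ g i = \1_A.
    by move=> i; have [A mA gE] := gA i isT; exists A.
  have := indep [set: 'I_n]%SET A (fun i => (mA i).1).
  set B := \bigcap_(i in _) _ => PB.
  transitivity (\int[P]_w (\1_B w)%:E)%E.
    apply: eq_integral => w _; congr (_%:E).
    under eq_bigr do rewrite (mA _).2.
    rewrite indicE; case: (boolP (w \in B)) => wB.
      rewrite big1// => i _; rewrite indicE mem_set//.
      by move: wB; rewrite inE; apply => /=; rewrite inE.
    have [i Ai] : exists i, ~ A i (eps i w).
      apply/existsNP => wA; move/negP: wB; apply; rewrite inE => i _; exact: wA.
    by rewrite (bigD1 i)//= indicE memNset// mul0r.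
  rewrite integral_indic//= ?setIT; last first.
    apply: fin_bigcap_measurable => // i _; rewrite -[X in measurable X]setTI.
    by apply: meps => //; case: (mA i).
  rewrite PB -prodEFin; apply: eq_big => [i|i _]; first by rewrite inE.
  rewrite law; last by case: (mA i).
  by rewrite /normal_prob -integral_mul_indic -(mA i).2.
have [nk|kn] := leqP n k.
  by apply: IHk => // i ki; have := ltn_ord i; rewrite ltnNge (leq_trans nk).
pose i0 := Ordinal kn.
(* The factors other than [i0] form the weight; the induction hypothesis, with an indicator at [i0],
   says that under this weight [eps i0] has density [cG * normal_pdf 0 sigma]. *)
pose G w := \prod_(i | i != i0) g i (eps i w).
pose cG := \prod_(i | i != i0) c i.
have G0 w : 0 <= G w by apply: prodr_ge0.
have c0 i : 0 <= c i.
  rewrite -lee_fin -gc integral_ge0// => x _.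
  by rewrite lee_fin mulr_ge0 ?normal_pdf_ge0.
have cG0 : 0 <= cG by apply: prodr_ge0.
have mG : measurable_fun setT G.
  rewrite /G; under eq_fun do rewrite -big_filter.
  by apply: measurable_prod => i _; exact: measurableT_comp.
have IH A : measurable A -> (\int[P]_w (G w * \1_A (eps i0 w))%:E =
    cG%:E * normal_prob 0 sigma A)%E.
  move=> mA.
  pose g' i := if i == i0 then \1_A else g i.
  pose c' i := if i == i0 then fine (normal_prob 0 sigma A) else c i.
  have := IHk g' c'.
  have -> : (\prod_i c' i)%:E = (cG%:E * normal_prob 0 sigma A)%E.
    rewrite (bigD1 i0)//= {1}/c' eqxx EFinM fineK ?fin_num_measure// muleC.
    congr (_%:E * _)%E; apply: eq_bigr => i /negPf ii0.
    by rewrite /c' ii0.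
  move=> <-.
  - apply: eq_integral => w _; rewrite [in RHS](bigD1 i0)//= {1}/g' eqxx mulrC.
    congr ((_ * _)%:E); apply: eq_bigr => i /negPf ii0.
    by rewrite /g' ii0.
  - by move=> i; rewrite /g'; case: ifP => // _; exact: measurable_indic.
  - by move=> i x; rewrite /g'; case: ifP.
  - move=> i; rewrite /g' /c'; case: ifP => // _.
    rewrite integral_mul_indic fineK// fin_num_measure//.
  - move=> i ki; rewrite /g'; case: eqP => [_|/eqP ii0]; first by exists A.
    by apply: gA; rewrite ltn_neqAle ki andbT; apply: contra ii0 => /eqP kE; apply/eqP/val_inj.
transitivity (\int[P]_w (G w * g i0 (eps i0 w))%:E)%E.
  by apply: eq_integral => w _; rewrite (bigD1 i0)//= mulrC.
have mpdf := @measurable_normal_pdf R 0 sigma.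
rewrite (@integral_density_comp _ _ _ _ _ _ (fun x => cG * normal_pdf 0 sigma x))//.
- under eq_integral do rewrite -mulrA EFinM.
  rewrite ge0_integralZl//=.
  + by rewrite gc -EFinM (bigD1 i0)//= mulrC.
  + by apply/measurable_EFinP; exact: (measurable_funM mpdf (mg i0)).
  + by move=> x _; rewrite lee_fin mulr_ge0// normal_pdf_ge0.
- exact: measurable_funM.
- by move=> x; rewrite mulr_ge0 ?normal_pdf_ge0.
- move=> A mA; rewrite IH// /normal_prob -ge0_integralZl//=.
  + by apply/measurable_EFinP; exact: measurable_funTS.
  + by move=> x _; rewrite lee_fin normal_pdf_ge0.
Qed.
End independent.

(** * Exponential moments of one Gaussian variable *)

Section gaussian_integrals.
Context {R : realType}.
Notation mu := (@lebesgue_measure R).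

Lemma integral_scale_normal_pdf (k m s : R) : 0 <= k ->
  (\int[mu]_x (k * normal_pdf m s x)%:E = k%:E)%E.
Proof.
move=> k0; under eq_integral do rewrite EFinM.
rewrite ge0_integralZl//= ?lee_fin//.
- by rewrite integral_normal_pdf mule1.
- by apply/measurable_EFinP; exact: measurable_normal_pdf.
- by move=> x _; rewrite lee_fin normal_pdf_ge0.
Qed.

(** Completing the square: the tilted density is a constant times the density with mean [s^2 t] and
    the same deviation. *)
Lemma integral_normal_pdf_expR (s t : R) : s != 0 ->
  (\int[mu]_x (normal_pdf 0 s x * expR (t * x))%:E =
   (expR (s ^+ 2 * t ^+ 2 / 2))%:E)%E.
Proof.
move=> s0; rewrite -(integral_scale_normal_pdf (s ^+ 2 * t) s (expR_ge0 _)).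
apply: eq_integral => x _; congr (_%:E).
rewrite /normal_pdf (negPf s0) -[LHS]mulrA [RHS]mulrCA; congr (_ * _).
rewrite /normal_fun -!expRD; congr expR.
by rewrite -[s ^+ 2 *+ 2]mulr_natr; field.
Qed.

(** Since [3/8 - 1/2 = -1/8], the integrand is twice the density of standard deviation 2. The
    exponent [3/8] is chosen for this clean value. *)
Lemma integral_normal_pdf_expR_sqr :
  (\int[mu]_x (normal_pdf 0 1 x * expR (3 / 8 * x ^+ 2))%:E = 2%:E)%E.
Proof.
rewrite -[in RHS](@integral_scale_normal_pdf 2 0 2)//.
apply: eq_integral => x _; congr (_%:E).
rewrite /normal_pdf oner_eq0 pnatr_eq0/= /normal_peak expr1n mul1r.
rewrite -[2 ^+ 2 * _ *+ 2]mulrnAr sqrtrM ?sqr_ge0// sqrtr_sqr ger0_norm//.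
rewrite invfM [RHS]mulrA [2 * _]mulrA mulfV ?pnatr_eq0// mul1r -[LHS]mulrA; congr (_ * _).
rewrite /normal_fun -!expRD !subr0; congr expR.
by rewrite expr1n; field.
Qed.
End gaussian_integrals.

Section gaussian_noise.
Context d (Omega : measurableType d) (R : realType) (P : probability Omega R).

Lemma gaussian_mgf (n : nat) (sigma : R) (eps : 'I_n -> Omega -> R)
    (t : 'I_n -> R) : gaussian_noise P sigma eps -> sigma != 0 ->
  (\int[P]_w (expR (\sum_i t i * eps i w))%:E =
   (expR (sigma ^+ 2 / 2 * \sum_i t i ^+ 2))%:E)%E.
Proof.
move=> Heps s0.
under eq_integral do rewrite expR_sum.
rewrite (integral_prod_gaussian Heps (g := fun i x => expR (t i * x))
  (c := fun i => expR (sigma ^+ 2 * t i ^+ 2 / 2))).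
- by rewrite -expR_sum mulr_sumr; congr ((expR _)%:E); apply: eq_bigr => i _; ring.
- by move=> i; apply: measurableT_comp => //; exact: measurable_funM.
- by move=> i x; exact: expR_ge0.
- by move=> i; exact: integral_normal_pdf_expR.
Qed.

(* Decoupling: [expR (3/8 v^2)] is the mean of [expR (c g v)] over a standard Gaussian [g] with
   [c^2 = 3/4], so Tonelli replaces the squares by linear forms one coordinate at a time. *)
Lemma expR_sqr_mgf (r : nat) (V : 'I_r -> Omega -> R) :
  (forall k, measurable_fun setT (V k)) ->
  (forall t : 'I_r -> R, \int[P]_w (expR (\sum_k t k * V k w))%:E =
     (expR (2^-1 * \sum_k t k ^+ 2))%:E)%E ->
  (\int[P]_w (expR (3 / 8 * \sum_k V k w ^+ 2))%:E = (2 ^+ r)%:E)%E.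
Proof.
move=> mV mgf.
(* At stage [j] the coordinates below [j] carry squares and the others still carry linear forms;
   stage 0 is the hypothesis on linear forms, stage [r] the claim. *)
pose e j (t : 'I_r -> R) (k : 'I_r) (v : R) := if (k < j)%N then 3 / 8 * v ^+ 2 else t k * v.
have me j t k : measurable_fun setT (e j t k).
  by rewrite /e; case: (k < j)%N; exact: measurable_funM.
suff H j : (j <= r)%N -> forall t : 'I_r -> R,
    (\int[P]_w (expR (\sum_k e j t k (V k w)))%:E =
     (2 ^+ j * expR (2^-1 * \sum_(k < r | (j <= k)%N) t k ^+ 2))%:E)%E.
  have := H r (leqnn r) (fun=> 0).
  rewrite big_pred0 ?mulr0 ?expR0 ?mulr1; last by move=> k; rewrite leqNgt ltn_ord.
  move=> <-; apply: eq_integral => w _; rewrite mulr_sumr.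
  by congr ((expR _)%:E); apply: eq_bigr => k _; rewrite /e ltn_ord.
elim: j => [_ t|j IHj jr t].
  by rewrite expr0 mul1r -mgf.
pose j0 := Ordinal jr.
pose c : R := Num.sqrt (3 / 4).
have c2 : c ^+ 2 = 3 / 4 by rewrite sqr_sqrtr// divr_ge0.
pose rest w := \sum_(k | k != j0) e j.+1 t k (V k w).
have mrest : measurable_fun setT rest.
  rewrite /rest; under eq_fun do rewrite -big_filter.
  by apply: measurable_sum => k; exact: measurableT_comp (me _ _ _) (mV k).
pose mu : {sigma_finite_measure set (measurableTypeR R) -> \bar R} := @lebesgue_measure R.
transitivity (\int[P]_w \int[mu]_g (normal_pdf 0 1 g * expR (rest w + c * g * V j0 w))%:E)%E.
  apply: eq_integral => w _.
  transitivity (\int[mu]_g ((expR (rest w))%:E *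
      (normal_pdf 0 1 g * expR ((c * V j0 w) * g))%:E))%E; last first.
    apply: eq_integral => g _; rewrite -EFinM; congr (_%:E).
    by rewrite expRD mulrCA; congr (_ * (_ * expR _)); ring.
  rewrite ge0_integralZl//= ?lee_fin ?expR_ge0//.
  - rewrite (@integral_normal_pdf_expR R 1 (c * V j0 w)) ?oner_eq0//.
    rewrite -EFinM -expRD (bigD1 j0)//= addrC; congr ((expR (_ + _))%:E).
    by rewrite /e ltnS leqnn exprMn c2; field.
  - apply/measurable_EFinP.
    apply: (@measurable_funM _ _ _ _ (normal_pdf 0 1) (fun g => expR (c * V j0 w * g))).
      exact: measurable_normal_pdf.
    by apply: measurableT_comp => //; exact: measurable_funM.
  - by move=> g _; rewrite lee_fin mulr_ge0 ?normal_pdf_ge0 ?expR_ge0.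
rewrite (fubini_tonelli (fun q : Omega * measurableTypeR R =>
  (normal_pdf 0 1 q.2 * expR (rest q.1 + c * q.2 * V j0 q.1))%:E)%E) /=; last 2 first.
- apply/measurable_EFinP; apply: measurable_funM.
    by apply: measurableT_comp => //; exact: measurable_normal_pdf.
  apply: measurableT_comp => //; apply: measurable_funD.
    exact: measurableT_comp mrest _.
  apply: measurable_funM; first exact: measurable_funM.
  exact: measurableT_comp (mV j0) _.
- by move=> q; rewrite lee_fin mulr_ge0 ?normal_pdf_ge0 ?expR_ge0.
pose K := 2 ^+ j * expR (2^-1 * \sum_(k < r | (j < k)%N) t k ^+ 2).
transitivity (\int[mu]_g (K%:E * (normal_pdf 0 1 g * expR (3 / 8 * g ^+ 2))%:E))%E.
  apply: eq_integral => g _.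
  under eq_integral do rewrite EFinM.
  rewrite ge0_integralZl//= ?lee_fin ?normal_pdf_ge0//; last first.
    apply/measurable_EFinP; apply: measurableT_comp => //; apply: measurable_funD => //.
    exact: measurable_funM.
  (* For fixed [g] the inner integral is the previous stage with coefficient [c * g] at [j0]. It
     contributes [expR (3/8 g^2)], whose Gaussian mean is the new factor 2. *)
  pose t' k := if k == j0 then c * g else t k.
  transitivity ((normal_pdf 0 1 g)%:E * \int[P]_w (expR (\sum_k e j t' k (V k w)))%:E)%E.
    congr (_ * _)%E; apply: eq_integral => w _; congr ((expR _)%:E).
    rewrite [in RHS](bigD1 j0)//= addrC; congr (_ + _); last first.
      by rewrite /e /= ltnn /t' eqxx.
    apply: eq_bigr => k kj; rewrite /e /t' (negPf kj) ltnS leq_eqVlt.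
    by rewrite -[k == j :> nat]/(k == j0) (negPf kj).
  rewrite IHj; last exact: ltnW.
  rewrite -!EFinM /K; congr (_%:E).
  rewrite (bigD1 j0)//= /t' eqxx exprMn c2.
  rewrite mulrDr expRD (_ : 2^-1 * (3 / 4 * g ^+ 2) = 3 / 8 * g ^+ 2); last by field.
  rewrite [in LHS](eq_big (fun k : 'I_r => (j < k)%N) (fun k => t k ^+ 2)); first by ring.
    by move=> k; rewrite andbC [in RHS]ltn_neqAle [in RHS]eq_sym.
  by move=> k /andP[_ /negPf->].
rewrite ge0_integralZl//=.
- by rewrite integral_normal_pdf_expR_sqr -EFinM /K exprS; congr (_%:E); ring.
- apply/measurable_EFinP.
  apply: (@measurable_funM _ _ _ _ (normal_pdf 0 1) (fun g => expR (3 / 8 * g ^+ 2))).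
    exact: measurable_normal_pdf.
  by apply: measurableT_comp => //; exact: measurable_funM.
- by move=> g _; rewrite lee_fin mulr_ge0 ?normal_pdf_ge0 ?expR_ge0.
- by rewrite lee_fin mulr_ge0 ?exprn_ge0 ?expR_ge0.
Qed.
End gaussian_noise.

(** * Tail bounds for projections of the noise *)

Section vectors.
Context {R : realType}.

(** The sum of the squares of [A b_i - C a_i] equals [A (A B - C^2)]. If [A = 0], all [a_i] vanish
    and so does [C]. *)
Lemma cauchy_schwarz_sum (I : finType) (Q : pred I) (a b : I -> R) :
  (\sum_(i | Q i) a i * b i) ^+ 2 <= (\sum_(i | Q i) a i ^+ 2) * (\sum_(i | Q i) b i ^+ 2).
Proof.
set C := \sum_(i | Q i) a i * b i; set A := \sum_(i | Q i) a i ^+ 2.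
set B := \sum_(i | Q i) b i ^+ 2.
have A0 : 0 <= A by apply: sumr_ge0 => i _; exact: sqr_ge0.
have : 0 <= \sum_(i | Q i) (A * b i - C * a i) ^+ 2.
  by apply: sumr_ge0 => i _; exact: sqr_ge0.
rewrite (eq_bigr (fun i =>
  A ^+ 2 * b i ^+ 2 - 2 * A * C * (a i * b i) + C ^+ 2 * a i ^+ 2)); last first.
  by move=> i _; ring.
rewrite big_split sumrB -!mulr_sumr -/A -/B -/C.
rewrite [X in 0 <= X](_ : _ = A * (A * B - C ^+ 2)); last by rewrite /=; ring.
move: A0; rewrite le_eqVlt => /predU1P[A0 _|A0]; last by rewrite pmulr_rge0// subr_ge0.
rewrite (_ : C = 0) ?expr0n/= -?A0 ?mul0r//.
rewrite /C big1// => i Qi; move/esym/eqP: A0; rewrite psumr_eq0; last by move=> j _; exact: sqr_ge0.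
by move=> /allP/(_ i); rewrite mem_index_enum Qi/= sqrf_eq0 => /(_ isT)/eqP->; rewrite mul0r.
Qed.

Lemma sqnorm_ge0 m (u : 'cV[R]_m) : 0 <= sqnorm u.
Proof. by apply: sumr_ge0 => i _; exact: sqr_ge0. Qed.

Lemma sqnorm_eq0 m (u : 'cV[R]_m) : (sqnorm u == 0) = (u == 0).
Proof.
apply/eqP/eqP => [u0|->]; last by rewrite /sqnorm big1// => i _; rewrite mxE expr0n.
apply/colP => i; rewrite mxE; move/eqP: u0; rewrite psumr_eq0; last by move=> j _; exact: sqr_ge0.
by move=> /allP/(_ i); rewrite mem_index_enum/= sqrf_eq0 => /(_ isT)/eqP.
Qed.

Lemma sqnormE m (u : 'cV[R]_m) : sqnorm u = (u^T *m u) 0 0.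
Proof. by rewrite mxE; apply: eq_bigr => i _; rewrite mxE expr2. Qed.

Lemma dotvE m (u v : 'cV[R]_m) : dotv u v = (u^T *m v) 0 0.
Proof. by rewrite mxE; apply: eq_bigr => i _; rewrite mxE. Qed.

Lemma dotv_le_norm m (u v : 'cV[R]_m) :
  `|dotv u v| <= Num.sqrt (sqnorm u) * Num.sqrt (sqnorm v).
Proof.
rewrite -sqrtrM ?sqnorm_ge0// -sqrtr_sqr ler_wsqrtr//.
exact: cauchy_schwarz_sum.
Qed.

(** Gram-Schmidt, one column at a time. A column already in the span of the others adds nothing to
    [U], hence [r <= p] without any rank assumption on [X]. *)
Lemma orthonormal_factor n p (X : 'M[R]_(n, p)) :
  exists r (U : 'M[R]_(n, r)) (C : 'M[R]_(r, p)),
    [/\ (r <= p)%N, U^T *m U = 1%:M & X = U *m C].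
Proof.
elim: p X => [|p IH] X.
  exists 0%N, 0, 0; split => //; last by apply/matrixP => i [].
  by apply/matrixP => -[].
move: X; rewrite -[p.+1]/(1 + p)%N => X.
have [r [U [C [rp UU XE]]]] := IH (rsubmx X).
pose x := lsubmx X; pose y := x - U *m (U^T *m x).
have Uy : U^T *m y = 0 by rewrite /y mulmxBr !mulmxA UU mul1mx subrr.
have [y0|y0] := eqVneq y 0.
  exists r, U, (row_mx (U^T *m x) C); split => //; first exact: leqW.
  rewrite mul_mx_row -XE -[LHS]hsubmxK; congr row_mx.
  by apply/eqP; rewrite -subr_eq0 -/y y0.
pose k := Num.sqrt (sqnorm y).
have k0 : 0 < k by rewrite sqrtr_gt0 lt_neqAle sqnorm_ge0 eq_sym sqnorm_eq0 y0.
pose u := k^-1 *: y.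
exists (1 + r)%N, (row_mx u U), (block_mx k%:M 0 (U^T *m x) C); split => //.
- rewrite tr_row_mx mul_col_row UU [U^T *m u]linearZ/= Uy scaler0.
  rewrite -[u^T *m U]trmxK trmx_mul trmxK [U^T *m u]linearZ/= Uy scaler0 trmx0.
  rewrite (_ : u^T *m u = 1%:M) -?scalar_mx_block//.
  apply/matrixP => i j; rewrite !ord1 -sqnormE mxE eqxx mulr1n.
  rewrite /sqnorm; under eq_bigr do rewrite mxE exprMn.
  by rewrite -mulr_sumr -/(sqnorm y) exprVn sqr_sqrtr ?sqnorm_ge0// mulVf// sqnorm_eq0.
- rewrite mul_row_block mulmx0 add0r -XE -[LHS]hsubmxK; congr row_mx.
  by rewrite -scalemxAl mul_mx_scalar scalerA mulVf ?gt_eqF// scale1r subrK.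
Qed.
End vectors.

Section tails.
Context d (Omega : measurableType d) (R : realType) (P : probability Omega R).
Variables (n : nat) (sigma : R) (eps : 'I_n -> Omega -> R).
Hypothesis Heps : gaussian_noise P sigma eps.
Hypothesis sigma_gt0 : 0 < sigma.

Lemma measurable_fun_coord_noise r (U : 'M[R]_(n, r)) (k : 'I_r) :
  measurable_fun setT (fun w => (U^T *m noise_vec eps w) k 0).
Proof.
have [meps _ _] := Heps.
under eq_fun do rewrite mxE.
apply: measurable_sum => i; under eq_fun do rewrite !mxE.
exact: measurable_funM.
Qed.

Lemma measurable_sqnorm_noise_gt r (U : 'M[R]_(n, r)) (c : R) :
  measurable [set w | c < sqnorm (U^T *m noise_vec eps w)].
Proof.
have mQ : measurable_fun setT (fun w => sqnorm (U^T *m noise_vec eps w)).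
  by apply: measurable_sum => k; apply: measurable_funX; exact: measurable_fun_coord_noise.
have := measurable_fun_ltr (measurable_cst c) mQ.
by move=> /(_ measurableT [set true]); rewrite setTI; exact.
Qed.

(** Chernoff bound at exponent [3/8]: the normalised coordinates [V] have the moment generating
    function of a standard Gaussian vector, so [expR_sqr_mgf] applies and gives the factor
    [2 ^+ r]. *)
Lemma sqnorm_noise_tail r (U : 'M[R]_(n, r)) (x : R) : U^T *m U = 1%:M ->
  (P [set w | (sigma ^+ 2 * x < sqnorm (U^T *m noise_vec eps w))%R] <=
   (2 ^+ r * expR (- (3 / 8 * x)))%:E)%E.
Proof.
move=> UU; have s0 : sigma != 0 by rewrite gt_eqF.
pose V k w := sigma^-1 * (U^T *m noise_vec eps w) k 0.
have mV k : measurable_fun setT (V k).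
  by apply: measurable_funM => //; exact: measurable_fun_coord_noise.
have VE w : \sum_k V k w ^+ 2 = sigma ^- 2 * sqnorm (U^T *m noise_vec eps w).
  by rewrite mulr_sumr; apply: eq_bigr => k _; rewrite exprMn exprVn.
have mgf t : (\int[P]_w (expR (\sum_k t k * V k w))%:E =
     (expR (2^-1 * \sum_k t k ^+ 2))%:E)%E.
  pose tv := \col_(k < r) t k.
  (* A linear form in [V] is a linear form in the noise with coefficients [U tv / sigma], and [U]
     preserves the norm of [tv]. *)
  transitivity (\int[P]_w (expR (\sum_i (sigma^-1 * (U *m tv) i 0) * eps i w))%:E)%E.
    apply: eq_integral => w _; congr ((expR _)%:E).
    transitivity (sigma^-1 * (tv^T *m (U^T *m noise_vec eps w)) 0 0).
      rewrite [in RHS]mxE mulr_sumr; apply: eq_bigr => k _.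
      by rewrite /V [in RHS]mxE [in RHS]mxE; ring.
    rewrite mulmxA -trmx_mul mxE mulr_sumr; apply: eq_bigr => i _.
    by rewrite [in LHS]mxE [noise_vec _ _ _ _]mxE; ring.
  rewrite (gaussian_mgf _ Heps)//; congr ((expR _)%:E).
  under eq_bigr do rewrite exprMn.
  rewrite -mulr_sumr -/(sqnorm (U *m tv)) sqnormE trmx_mul -mulmxA (mulmxA U^T) UU mul1mx.
  rewrite -sqnormE /sqnorm mulrA; congr (_ * _); first by field.
  by apply: eq_bigr => k _; rewrite mxE.
have := expR_sqr_mgf mV mgf.
set B := [set w | _] => E2.
have mB : measurable B by exact: measurable_sqnorm_noise_gt.
rewrite (_ : P B = \int[P]_w (\1_B w)%:E)%E; last by rewrite integral_indic// setIT.
have mE : measurable_fun setT (fun w => (expR (3 / 8 * \sum_k V k w ^+ 2))%:E).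
  apply/measurable_EFinP; apply: measurableT_comp => //; apply: measurable_funM => //.
  by apply: measurable_sum => k; exact: measurable_funX.
rewrite mulrC EFinM -E2 -ge0_integralZl//=.
apply: ge0_le_integral => //=.
- by apply/measurable_EFinP; exact: measurable_indic.
- exact: emeasurable_funM.
- move=> w _; rewrite -EFinM lee_fin -expRD indicE.
  case: (boolP (w \in B)) => wB; last exact: expR_ge0.
  (* Markov's inequality pointwise: on [B] the exponent is positive, so its exponential is at least
     1. *)
  apply: le_trans (expR_ge1Dx _); rewrite lerDl VE.
  have : x < sigma ^- 2 * sqnorm (U^T *m noise_vec eps w).
    by rewrite mulrC ltr_pdivlMr ?exprn_gt0// mulrC; rewrite inE in wB.
  by move: (_ * sqnorm _) => q xq; lra.
Qed.
End tails.

(** * Counting estimates for the union bound over subsets *)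

Section counting.
Context {R : realType}.

Lemma expR1_le4 : expR 1 <= 4 :> R.
Proof.
have h : expR (- (1 / 2)) >= 1 / 2 :> R.
  by apply: le_trans (expR_ge1Dx _); lra.
have : expR (- 1) >= 1 / 4 :> R.
  rewrite (_ : - 1 = - (1 / 2) + - (1 / 2)); last by field.
  by rewrite expRD; nra.
by rewrite expRN mul1r lef_pV2 ?posrE ?expR_gt0.
Qed.

Lemma expR_nat_le (j : nat) : expR j%:R <= 4 ^+ j :> R.
Proof.
rewrite -[j%:R]mulr1 expRM_natl lerXn2r ?nnegrE ?expR_ge0//.
exact: expR1_le4.
Qed.

(** The subtracted term lets the induction close, as [1/8 <= 7/16]. The constant one half becomes
    the one in the probability bound. *)
Lemma sum_inv8_le (m : nat) :
  \sum_(j < m.+1 | (0 < j)%N) (8^-1) ^+ j <= 2^-1 * (1 - (8^-1) ^+ m) :> R.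
Proof.
elim: m => [|m IH].
  by rewrite big_mkcond big_ord_recl big_ord0/= expr0 subrr mulr0 addr0.
rewrite big_mkcond big_ord_recr/= -big_mkcond/= (le_trans (lerD IH (lexx _)))//.
have : 0 <= 8^-1 ^+ m :> R by rewrite exprn_ge0// invr_ge0.
by rewrite !exprS; move: (8^-1 ^+ m) => x; lra.
Qed.

(** With [u = j / (2n) <= 1/2], the left side splits into ['C(n, j) (2u)^j], [u^(7j)] and [u^j].
    They are at most [4^j], [2^(-7j)] and [(s/(2n))^s 4^j], and [4 * 4 / 2^7 = 1/8]. *)
Lemma bin_union_bound (n s j : nat) : (0 < s)%N -> (s <= j)%N -> (j <= n)%N ->
  'C(n, j)%:R * (2 ^+ j * (j%:R / (2 * n%:R)) ^+ (9 * j)) <=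
  (s%:R / (2 * n%:R)) ^+ s * (8^-1) ^+ j :> R.
Proof.
move=> s0 sj jn.
have j0 : (0 < j)%N by exact: leq_trans s0 sj.
have n0 : (0 < n)%N by exact: leq_trans j0 jn.
have nR : 0 < n%:R :> R by rewrite ltr0n.
have sR : 0 < s%:R :> R by rewrite ltr0n.
set u : R := j%:R / (2 * n%:R).
have u0 : 0 <= u by rewrite divr_ge0// mulr_ge0.
have u2 : u <= 2^-1.
  by rewrite ler_pdivrMr ?mulr_gt0// mulKf// ler_nat.
(* One term of the binomial expansion of [(1 + 2u)^n], which is at most [expR (2 u n) = expR j]. *)
have h1 : 'C(n, j)%:R * (2 * u) ^+ j <= 4 ^+ j.
  apply: le_trans (expR_nat_le j).
  have -> : j%:R = n%:R * (2 * u) :> R by rewrite /u; field; rewrite gt_eqF.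
  rewrite expRM_natl; apply: (@le_trans _ _ ((1 + 2 * u) ^+ n)); last first.
    by rewrite lerXn2r ?nnegrE ?expR_ge0 ?expR_ge1Dx// addr_ge0// mulr_ge0.
  rewrite exprDn (bigD1 (Ordinal (jn : (j < n.+1)%N)))//= expr1n mul1r mulr_natl lerDl.
  by apply: sumr_ge0 => i _; rewrite mulrn_wge0// expr1n mul1r exprn_ge0// mulr_ge0.
have h2 : u ^+ (7 * j) <= (2^-1) ^+ (7 * j).
  by rewrite lerXn2r ?nnegrE// invr_ge0.
(* As [u <= 1], [u^j <= u^s = (s/(2n))^s (j/s)^s], and [j/s <= expR (j/s)] bounds the last factor by
   [expR j]. *)
have h3 : u ^+ j <= (s%:R / (2 * n%:R)) ^+ s * 4 ^+ j.
  rewrite -(subnKC sj) exprD subnKC//.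
  apply: (@le_trans _ _ (u ^+ s)).
    rewrite ler_piMr ?exprn_ge0// exprn_ile1// (le_trans u2)//; lra.
  have -> : u = s%:R / (2 * n%:R) * (j%:R / s%:R).
    by rewrite /u; field; rewrite !gt_eqF.
  rewrite exprMn ler_wpM2l ?exprn_ge0 ?divr_ge0 ?mulr_ge0//.
  apply: le_trans (expR_nat_le j).
  have {2}-> : j%:R = s%:R * (j%:R / s%:R) :> R by field; rewrite gt_eqF.
  rewrite expRM_natl lerXn2r ?nnegrE ?expR_ge0 ?divr_ge0//.
  by apply: le_trans (expR_ge1Dx _); lra.
have -> : 'C(n, j)%:R * (2 ^+ j * u ^+ (9 * j)) =
  ('C(n, j)%:R * (2 * u) ^+ j) * u ^+ (7 * j) * u ^+ j.
  rewrite (_ : 9 * j = j + (7 * j + j))%N; last by lia.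
  rewrite [u ^+ (j + _)]exprD [u ^+ (7 * j + _)]exprD [(2 * u) ^+ j]exprMn.
  by rewrite !mulrA.
apply: (@le_trans _ _ (4 ^+ j * (2^-1) ^+ (7 * j) * ((s%:R / (2 * n%:R)) ^+ s * 4 ^+ j))).
  apply: ler_pM => //; rewrite ?mulr_ge0 ?exprn_ge0 ?mulr_ge0//.
  by apply: ler_pM => //; rewrite ?mulr_ge0 ?exprn_ge0 ?mulr_ge0//.
rewrite mulrCA ler_wpM2l// ?exprn_ge0 ?divr_ge0 ?mulr_ge0//.
rewrite exprM -!exprMn.
by rewrite (_ : _ * _ = 8^-1); last by field.
Qed.

(** The sets are grouped by cardinality [j], with at most ['C(n, j)] in each group; the remaining
    geometric series starts at 1 because [s > 0]. *)
Lemma sum_sets_union_bound (n s : nat) : (0 < s)%N ->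
  \sum_(S : {set 'I_n} | (s <= #|S|)%N)
     2 ^+ #|S| * (#|S|%:R / (2 * n%:R)) ^+ (9 * #|S|) <=
  2^-1 * (s%:R / (2 * n%:R)) ^+ s :> R.
Proof.
move=> s0.
pose F (j : nat) : R := 2 ^+ j * (j%:R / (2 * n%:R)) ^+ (9 * j).
have card_lt (S : {set 'I_n}) : (#|S| < n.+1)%N by rewrite ltnS -[X in (_ <= X)%N]card_ord max_card.
rewrite (partition_big (fun S : {set 'I_n} => Ordinal (card_lt S))
  (fun j : 'I_n.+1 => (s <= j)%N))//=.
apply: (@le_trans _ _ (\sum_(j < n.+1 | (s <= j)%N) (s%:R / (2 * n%:R)) ^+ s * (8^-1) ^+ j)).
  apply: ler_sum => j sj; apply: le_trans (bin_union_bound s0 sj _); last by rewrite -ltnS.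
  rewrite (eq_bigr (fun=> F j)); last by move=> S /andP[_ /eqP <-].
  rewrite sumr_const -[leLHS]mulr_natl.
  rewrite -/(F j) ler_wpM2r//.
    by rewrite mulr_ge0// exprn_ge0// divr_ge0// mulr_ge0.
  rewrite ler_nat -[X in 'C(X, _)]card_ord -cardsT -cards_draws -cardsE.
  apply: subset_leq_card; apply/fintype.subsetP => S; rewrite !inE => /andP[_ /eqP jE].
  by rewrite finset.subsetT/= -jE.
rewrite -mulr_sumr mulrC ler_wpM2r//.
apply: (@le_trans _ _ (\sum_(j < n.+1 | (0 < j)%N) (8^-1) ^+ j)).
  rewrite big_mkcond [leRHS]big_mkcond; apply: ler_sum => j _.
  case: ifPn => [sj|_]; first by rewrite (leq_trans s0 sj).
  by case: ifP => // _; rewrite exprn_ge0// invr_ge0.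
apply: le_trans (sum_inv8_le n) _.
by rewrite ler_piMr ?invr_ge0// gerBl exprn_ge0// invr_ge0.
Qed.
End counting.

Lemma measure_bigsetU_le d (T : measurableType d) (R : realType)
    (m : {measure set T -> \bar R}) (I : Type) (r : seq I) (Q : pred I)
    (F : I -> set T) : (forall i, measurable (F i)) ->
  (m (\big[setU/set0]_(i <- r | Q i) F i) <= \sum_(i <- r | Q i) m (F i))%E.
Proof.
move=> mF; elim: r => [|i r IH]; first by rewrite !big_nil measure0.
rewrite !big_cons; case: (Q i) => //.
have mr : measurable (\big[setU/set0]_(j <- r | Q j) F j).
  by apply: bigsetU_measurable.
apply: le_trans (measureU2 m (mF i) mr) _.
by rewrite leeD.
Qed.

(** * The two exceptional noise events *)

Section event.
Context d (Omega : measurableType d) (R : realType) (P : probability Omega R).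
Variables (n : nat) (sigma : R) (eps : 'I_n -> Omega -> R).
Hypothesis Heps : gaussian_noise P sigma eps.
Hypothesis sigma_gt0 : 0 < sigma.

(** Writing [X = U C], both sides depend only on [U^T eps] and [C b], and Cauchy-Schwarz reduces the
    claim to one tail event. *)
Lemma noise_event_design p (X : 'M[R]_(n, p)) :
  exists B : set Omega, [/\ measurable B, (P B <= (expR (- p%:R))%:E)%E &
    forall w, ~ B w -> forall b : 'cV[R]_p,
      `|dotv (noise_vec eps w) (X *m b)| <=
      sigma * Num.sqrt (5 * p%:R) * Num.sqrt (sqnorm (X *m b))].
Proof.
have [r [U [C [rp UU ->]]]] := orthonormal_factor X.
exists [set w | sigma ^+ 2 * (5 * p%:R) < sqnorm (U^T *m noise_vec eps w)]; split.
- exact: (measurable_sqnorm_noise_gt Heps).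
- apply: le_trans (sqnorm_noise_tail Heps sigma_gt0 _ UU) _.
  rewrite lee_fin.
  (* The tail at level [5 p] is at most [2^p expR (-15 p / 8)], so [2 <= expR (7/8)] leaves
     [expR (-p)]. *)
  have h : 2 <= expR (7 / 8) :> R.
    rewrite (_ : 7 / 8 = 7 / 16 + 7 / 16); last by field.
    have : 1 + 7 / 16 <= expR (7 / 16) :> R by exact: expR_ge1Dx.
    by rewrite expRD; nra.
  apply: (@le_trans _ _ (expR (7 / 8) ^+ p * expR (- (3 / 8 * (5 * p%:R))))).
    rewrite ler_wpM2r ?expR_ge0//; apply: (@le_trans _ _ (2 ^+ p)).
      by rewrite ler_weXn2l// ler1n.
    by rewrite lerXn2r ?nnegrE ?expR_ge0.
  by rewrite -expRM_natl -expRD ler_expR; lra.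
- move=> w /= /negP; rewrite -leNgt => h b.
  have -> : dotv (noise_vec eps w) (U *m C *m b) = dotv (U^T *m noise_vec eps w) (C *m b).
    by rewrite !dotvE trmx_mul trmxK !mulmxA.
  have -> : sqnorm (U *m C *m b) = sqnorm (C *m b).
    by rewrite !sqnormE -mulmxA [(U *m _)^T]trmx_mul -mulmxA (mulmxA U^T) UU mul1mx.
  apply: le_trans (dotv_le_norm _ _) _; rewrite ler_wpM2r//.
  rewrite -[sigma]gtr0_norm// -sqrtr_sqr -sqrtrM ?sqr_ge0//.
  by rewrite ler_wsqrtr.
Qed.

(** A union bound over [S]: as [3/8 * 24 = 9], the exponential factor in the tail becomes
    [(|S| / (2n))^(9 |S|)]. *)
Lemma noise_event_subsets s : (0 < s)%N ->
  exists B : set Omega, [/\ measurable B,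
    (P B <= (2^-1 * (s%:R / (2 * n%:R)) ^+ s)%:E)%E &
    forall w, ~ B w -> forall S : {set 'I_n}, (s <= #|S|)%N ->
      \sum_(i in S) eps i w ^+ 2 <= 24 * sigma ^+ 2 * (#|S|%:R * ln (2 * n%:R / #|S|%:R))].
Proof.
move=> s0.
(* The columns are the basis vectors indexed by [S], so [(U S)^T] restricts the noise to [S]. *)
pose U (S : {set 'I_n}) : 'M[R]_(n, #|S|) := \matrix_(i, k) (i == enum_val k)%:R.
have UU S : (U S)^T *m U S = 1%:M.
  apply/matrixP => k l; rewrite !mxE (bigD1 (enum_val k))//= !mxE eqxx mul1r.
  rewrite big1 ?addr0 ?(inj_eq enum_val_inj)// => i /negPf ik.
  by rewrite !mxE ik mul0r.
have UE S w : sqnorm ((U S)^T *m noise_vec eps w) = \sum_(i in S) eps i w ^+ 2.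
  rewrite [RHS]big_enum_val; apply: eq_bigr => k _; congr (_ ^+ 2).
  rewrite mxE (bigD1 (enum_val k))//= !mxE eqxx mul1r.
  by rewrite big1 ?addr0// => i /negPf ik; rewrite !mxE ik mul0r.
pose x (S : {set 'I_n}) : R := 24 * (#|S|%:R * ln (2 * n%:R / #|S|%:R)).
pose F S := [set w | sigma ^+ 2 * x S < sqnorm ((U S)^T *m noise_vec eps w)].
have mF S : measurable (F S) by exact: (measurable_sqnorm_noise_gt Heps).
exists (\big[setU/set0]_(S : {set 'I_n} | (s <= #|S|)%N) F S); split.
- exact: bigsetU_measurable.
- apply: le_trans (measure_bigsetU_le _ _ _ mF) _.
  apply: (@le_trans _ _ (\sum_(S : {set 'I_n} | (s <= #|S|)%N)
     (2 ^+ #|S| * (#|S|%:R / (2 * n%:R)) ^+ (9 * #|S|))%:E)%E); last first.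
    by rewrite sumEFin lee_fin; exact: sum_sets_union_bound.
  apply: lee_sum => S sS.
  apply: le_trans (sqnorm_noise_tail Heps sigma_gt0 _ (UU S)) _.
  rewrite lee_fin ler_wpM2l ?exprn_ge0//.
  have jR : 0 < #|S|%:R :> R by rewrite ltr0n (leq_trans s0).
  have nR : 0 < n%:R :> R.
    by rewrite ltr0n (leq_trans s0)// (leq_trans sS)// -[X in (_ <= X)%N]card_ord max_card.
  rewrite (_ : - _ = (9 * #|S|)%:R * - ln (2 * n%:R / #|S|%:R)); last first.
    by rewrite /x natrM; field.
  rewrite expRM_natl expRN lnK; last by rewrite posrE divr_gt0// mulr_gt0.
  by rewrite invfM invrK mulrC.
- move=> w wB S sS; rewrite -UE leNgt; apply/negP => h; apply: wB.
  rewrite -bigcup_seq_cond; exists S => //=; first by rewrite mem_index_enum.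
  by rewrite /F /= /x; move: h; rewrite mulrAC [24 * _ * _]mulrC.
Qed.
End event.

(** * The sorted l1 norm *)

Section abel.
Context {R : realType}.

(** Summation by parts, run as an induction: since partial sums are nonnegative and weights
    decrease, the last weight times the partial sum stays below the weighted sum. *)
Lemma abel_sum_ge0 (n : nat) (w e : nat -> R) :
  (forall i j, (i <= j)%N -> (j < n)%N -> w j <= w i) ->
  (forall i, (i < n)%N -> 0 <= w i) ->
  (forall j, (j <= n)%N -> 0 <= \sum_(i < j) e i) ->
  0 <= \sum_(i < n) w i * e i.
Proof.
case: n => [|n] wmon w0 e0; first by rewrite big_ord0.
suff H k : (k <= n)%N -> w k * \sum_(i < k.+1) e i <= \sum_(i < k.+1) w i * e i.
  by apply: le_trans (H n (leqnn n)); rewrite mulr_ge0// ?w0// e0.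
elim: k => [_|k IH kn]; first by rewrite !big_ord1.
rewrite big_ord_recr [leRHS]big_ord_recr/= mulrDr lerD2r.
apply: le_trans (IH (ltnW kn)); rewrite ler_wpM2r ?e0//; first exact: leqW.
by rewrite wmon.
Qed.

Lemma abel_sum_le (n : nat) (w a b : 'I_n -> R) :
  (forall i j : 'I_n, (i <= j)%N -> w j <= w i) -> (forall i, 0 <= w i) ->
  (forall j, (j <= n)%N -> \sum_(i < n | (i < j)%N) a i <= \sum_(i < n | (i < j)%N) b i) ->
  \sum_i w i * a i <= \sum_i w i * b i.
Proof.
move=> wmon w0 ab.
pose ext (f : 'I_n -> R) k := oapp f 0 (insub k).
have extE f (i : 'I_n) : ext f i = f i by rewrite /ext valK.
rewrite -subr_ge0 -sumrB.
rewrite (eq_bigr (fun i : 'I_n => ext w i * ext (fun i => b i - a i) i)); last first.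
  by move=> i _; rewrite !extE mulrBr.
apply: abel_sum_ge0 => [i j ij jn|i ni|j jn].
- by rewrite -[j]/(val (Ordinal jn)) -[i]/(val (Ordinal (leq_ltn_trans ij jn))) !extE wmon.
- by rewrite -[i]/(val (Ordinal ni)) extE.
- rewrite (big_ord_widen n)//; under eq_bigr do rewrite extE.
  by rewrite sumrB subr_ge0 ab.
Qed.
End abel.

Section sorted.
Context {R : realType} {n : nat}.
Implicit Types u v m : 'cV[R]_n.

(** Sorting the indices by [|u_i|], instead of the values, exhibits the sorting permutation. *)
Lemma sorted_abs_perm u : exists2 f : 'I_n -> 'I_n, injective f &
  forall j : 'I_n, sorted_abs u j = `|u (f j) 0|.
Proof.
pose e := sort (relpre (fun i => `|u i 0|) (fun a b : R => b <= a)) (enum 'I_n).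
have se : size e = n by rewrite size_sort size_enum_ord.
exists (fun j => nth j e j) => [i j /eqP|j].
  rewrite (set_nth_default j) ?se// nth_uniq ?se// ?sort_uniq ?enum_uniq//.
  by move=> /eqP/val_inj.
by rewrite /sorted_abs sort_map (nth_map j)// se.
Qed.

Lemma sorted_abs_mono u (i j : nat) : (i <= j)%N -> (j < n)%N ->
  sorted_abs u j <= sorted_abs u i.
Proof.
move=> ij jn; rewrite /sorted_abs.
set l := sort _ _.
have sl : size l = n by rewrite size_sort size_map size_enum_ord.
have := @sorted_leq_nth R (fun a b : R => b <= a) _ _ 0 l.
apply; rewrite ?inE ?sl//.
- by move=> x y z yx zx; exact: le_trans zx yx.
- by apply: sort_sorted => x y; exact: le_total.
- exact: leq_ltn_trans jn.
Qed.

Lemma sorted_abs_ge0 u (j : 'I_n) : 0 <= sorted_abs u j.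
Proof. by have [f _ ->] := sorted_abs_perm u. Qed.

(** Pigeonhole: if the conclusion failed, the indices of the [j + 1] largest entries would all lie
    among the [j] indices [g k] with [k < j]. *)
Lemma sorted_abs_le u (g : 'I_n -> 'I_n) (j : 'I_n) (t : R) : injective g ->
  (forall k : 'I_n, (j <= k)%N -> `|u (g k) 0| <= t) -> sorted_abs u j <= t.
Proof.
move=> gi gt; have [f fi fE] := sorted_abs_perm u.
rewrite leNgt; apply/negP => tj.
have /subset_leq_card : f @: [set i : 'I_n | (i <= j)%N]%SET \subset
    g @: [set k : 'I_n | (k < j)%N]%SET.
  apply/fintype.subsetP => _ /imsetP[i ij ->]; rewrite inE in ij.
  have [k kE] : exists k, f i = g k.
    by have [h hK Kh] := injF_bij gi; exists (h (f i)).
  rewrite kE imset_f// inE ltnNge; apply/negP => /gt.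
  rewrite -kE -fE leNgt => /negP; apply; apply: lt_le_trans tj _.
  exact: sorted_abs_mono.
rewrite !card_imset// -!sum1dep_card.
have cardE (k : nat) : (k <= n)%N -> (\sum_(i < n | (i < k)%N) 1 = k)%N.
  by move=> kn; rewrite -(big_ord_widen n (fun=> 1%N))// sum1_card card_ord.
rewrite (cardE j)//; last exact: ltnW.
by rewrite (cardE j.+1)// ltnn.
Qed.

Lemma top_sum_le u (g : 'I_n -> 'I_n) (j : nat) : injective g -> (j <= n)%N ->
  \sum_(i < n | (i < j)%N) `|u (g i) 0| <= \sum_(i < n | (i < j)%N) sorted_abs u i.
Proof.
move=> gi; case: j => [_|j jn]; first by rewrite !big_pred0.
have [f fi fE] := sorted_abs_perm u.
(* [t] is the smallest of the selected largest entries. Replacing [x - t] by its positive part makes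
   the sum over all indices permutation invariant, and in sorted order it equals the head sum. *)
pose t := sorted_abs u (Ordinal jn).
rewrite -(lerD2r (- \sum_(i < n | (i < j.+1)%N) t)) -!sumrB.
pose pos (x : R) := Num.max (x - t) 0.
apply: (@le_trans _ _ (\sum_(i < n) pos `|u (g i) 0|)).
  rewrite [leRHS](bigID (fun i : 'I_n => (i < j.+1)%N))/= ler_wpDr//.
    by apply: sumr_ge0 => i _; rewrite le_max lexx orbT.
  by apply: ler_sum => i _; rewrite le_max lexx.
rewrite -(reindex_inj (F := fun i => pos `|u i 0|) (P := predT) gi)/=.
rewrite (reindex_inj fi)/=.
rewrite [leLHS](bigID (fun i : 'I_n => (i < j.+1)%N))/= [X in _ + X]big1 ?addr0.
  apply: ler_sum => i ij; rewrite /pos -fE ge_max lexx/= subr_ge0.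
  exact: sorted_abs_mono.
move=> i; rewrite -leqNgt => ji; apply/eqP; rewrite eq_le /pos le_max lexx orbT andbT.
rewrite -fE ge_max lexx andbT subr_le0.
by apply: sorted_abs_mono => //; exact: ltnW.
Qed.

Lemma rearrangement (w : 'I_n -> R) u (g : 'I_n -> 'I_n) :
  (forall i j : 'I_n, (i <= j)%N -> w j <= w i) -> (forall i, 0 <= w i) -> injective g ->
  \sum_j w j * `|u (g j) 0| <= \sum_j w j * sorted_abs u j.
Proof.
by move=> wmon w0 gi; apply: abel_sum_le => // j jn; exact: top_sum_le.
Qed.

Section weights.
Variable w : 'I_n -> R.
Hypothesis wmon : forall i j : 'I_n, (i <= j)%N -> w j <= w i.
Hypothesis w0 : forall i, 0 <= w i.

Lemma Jsl0 : Jsl w 0 = 0.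
Proof.
have [f _ fE] := sorted_abs_perm 0.
by rewrite /Jsl big1// => j _; rewrite fE mxE normr0 mulr0.
Qed.

(** Along the permutation sorting the combination, the triangle inequality splits the sum, and
    [rearrangement] bounds each part by its own sorted norm. *)
Lemma Jsl_convex u v (t : R) : 0 <= t <= 1 ->
  Jsl w ((1 - t) *: u + t *: v) <= (1 - t) * Jsl w u + t * Jsl w v.
Proof.
move=> /andP[t0 t1]; have [f fi fE] := sorted_abs_perm ((1 - t) *: u + t *: v).
apply: (@le_trans _ _ (\sum_j ((1 - t) * (w j * `|u (f j) 0|) + t * (w j * `|v (f j) 0|)))).
  apply: ler_sum => j _; rewrite fE 2!mxE [(t *: v) _ _]mxE.
  rewrite !(mulrCA _ (w j)) -mulrDr ler_wpM2l//.
  apply: le_trans (ler_normD _ _) _; rewrite !normrM.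
  by rewrite (ger0_norm t0) ger0_norm ?subr_ge0.
rewrite big_split/= -!mulr_sumr lerD// ler_wpM2l ?subr_ge0//; exact: rearrangement.
Qed.

(** Weights cut to 0 from position [s] on are still non-increasing, so [rearrangement] applies. *)
Lemma head_sum_le (s : nat) u (g : 'I_n -> 'I_n) : injective g ->
  \sum_(j < n | (j < s)%N) w j * `|u (g j) 0| <= \sum_(j < n | (j < s)%N) w j * sorted_abs u j.
Proof.
move=> gi; rewrite big_mkcond [leRHS]big_mkcond/=.
pose w' (j : 'I_n) := if (j < s)%N then w j else 0.
have wE (F : 'I_n -> R) : \sum_(j < n) (if (j < s)%N then w j * F j else 0) = \sum_j w' j * F j.
  by apply: eq_bigr => j _; rewrite /w'; case: ifP => // _; rewrite mul0r.
rewrite !wE; apply: rearrangement => // [i j ij|j]; rewrite /w'; last by case: ifP.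
case: ifPn => [js|_]; first by rewrite (leq_ltn_trans ij js) wmon.
by case: ifP.
Qed.

(* The permutation [f] lists the support of [mu] first, by decreasing [|mu_i|], and then the
   other indices by decreasing [|m_i|]; testing [Jsl w (mu + m)] against it gives the bound. *)
Lemma Jsl_sparse_sub_le (s : nat) (mu m : 'cV[R]_n) : (l0 mu <= s)%N ->
  Jsl w mu - Jsl w (mu + m) <=
  \sum_(j < n | (j < s)%N) w j * sorted_abs m j -
  \sum_(j < n | ~~ (j < s)%N) w j * sorted_abs m j.
Proof.
move=> mus.
pose M := \sum_i `|m i 0|.
have mM i : `|m i 0| <= M.
  by rewrite /M (bigD1 i)//= lerDl; apply: sumr_ge0.
(* The offset [1 + M] exceeds every [|m_i|], so sorting by [key] places the support of [mu]
   first. *)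
pose key : 'cV[R]_n := \col_i (if mu i 0 != 0 then 1 + M + `|mu i 0| else `|m i 0|).
have [f fi fE] := sorted_abs_perm key.
have M0 : 0 <= M by apply: sumr_ge0.
have keyE i : `|key i 0| = if mu i 0 != 0 then 1 + M + `|mu i 0| else `|m i 0|.
  by rewrite mxE ger0_norm//; case: ifP => // _; rewrite !addr_ge0.
have keymon (j k : 'I_n) : (j <= k)%N -> `|key (f k) 0| <= `|key (f j) 0|.
  by move=> jk; rewrite -!fE; exact: sorted_abs_mono.
have down (j k : 'I_n) : (j <= k)%N -> mu (f k) 0 != 0 -> mu (f j) 0 != 0.
  move=> jk fk; have := keymon _ _ jk; rewrite !keyE fk.
  case: (mu (f j) 0 != 0) => // h; have := mM (f j); have := normr_ge0 (mu (f k) 0); lra.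
have supp_lt (j : 'I_n) : mu (f j) 0 != 0 -> (j < s)%N.
  move=> fj; apply: leq_trans mus.
  have -> : j.+1 = #|f @: [set i : 'I_n | (i < j.+1)%N]%SET|.
    rewrite card_imset// -sum1dep_card -(big_ord_widen n (fun=> 1%N))//.
    by rewrite sum1_card card_ord.
  apply: subset_leq_card; apply/fintype.subsetP => _ /imsetP[i ij ->]; rewrite inE in ij.
  by apply: mem_set; exact: (down i j).
have Jmu : Jsl w mu <= \sum_j w j * `|mu (f j) 0|.
  apply: ler_sum => j _; rewrite ler_wpM2l//; apply: (sorted_abs_le fi) => k jk.
  have [->|fk] := eqVneq (mu (f k) 0) 0; first by rewrite normr0.
  by have := keymon _ _ jk; rewrite !keyE fk (down _ _ jk fk) lerD2l.
have Jmum : \sum_j w j * `|(mu + m) (f j) 0| <= Jsl w (mu + m) by exact: rearrangement.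
have tail : \sum_(j < n | ~~ (j < s)%N) w j * sorted_abs m j <=
    \sum_(j < n | ~~ (j < s)%N) w j * `|m (f j) 0|.
  apply: ler_sum => j js; rewrite ler_wpM2l//; apply: (sorted_abs_le fi) => k jk.
  have nsupp (i : 'I_n) : (j <= i)%N -> mu (f i) 0 = 0.
    move=> ji; apply/eqP; apply: contraNT js => /supp_lt; exact: leq_ltn_trans.
  by have := keymon _ _ jk; rewrite !keyE !nsupp ?eqxx.
(* The triangle inequality handles positions below [s]; beyond them [mu] vanishes and [m] alone
   remains. *)
have main : \sum_j w j * `|mu (f j) 0| - \sum_j w j * `|(mu + m) (f j) 0| <=
    \sum_(j < n | (j < s)%N) w j * `|m (f j) 0| - \sum_(j < n | ~~ (j < s)%N) w j * `|m (f j) 0|.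
  rewrite -sumrB (bigID (fun j : 'I_n => (j < s)%N))/= -sumrN lerD//.
    apply: ler_sum => j _; rewrite -mulrBr ler_wpM2l// mxE.
    by rewrite -[X in `|X| - _](addrK (m (f j) 0)) lerBlDl ler_normB.
  apply: ler_sum => j js; have /eqP mj : mu (f j) 0 == 0.
    by apply: contraNT js; exact: supp_lt.
  by rewrite mxE mj normr0 mulr0 !add0r.
have := head_sum_le s m fi; lra.
Qed.
End weights.
End sorted.

(** * The tuning sequence *)

Section lam.
Context {R : realType}.
Variables (sigma : R) (n : nat).
Hypotheses (sigma_gt0 : 0 < sigma) (n_gt0 : (0 < n)%N).

Lemma lam_seq_ge0 i : 0 <= lam_seq sigma n i.
Proof. by rewrite mulr_ge0// ltW. Qed.

Lemma lam_seq_mono i j : (0 < i)%N -> (i <= j)%N -> lam_seq sigma n j <= lam_seq sigma n i.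
Proof.
move=> i0 ij; have j0 := leq_trans i0 ij.
have nR : 0 < n%:R :> R by rewrite ltr0n.
apply: ler_wpM2l; first exact: ltW.
rewrite ler_wsqrtr// ler_ln ?posrE ?divr_gt0 ?mulr_gt0 ?ltr0n//.
by rewrite ler_pM2l ?mulr_gt0// lef_pV2 ?posrE ?ltr0n// ler_nat.
Qed.

Lemma lam_seq_sqr i : (0 < i)%N -> (i <= n)%N ->
  lam_seq sigma n i ^+ 2 = sigma ^+ 2 * ln (2 * n%:R / i%:R).
Proof.
move=> i0 ni; rewrite exprMn sqr_sqrtr// ln_ge0//.
rewrite ler_pdivlMr ?ltr0n// mul1r -natrM ler_nat; lia.
Qed.

(** The lower Stirling bound [ln s! >= s ln s - s], by induction from [ln (1 + 1/s) <= 1/s]. The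
    term [- s] produces the factor [e] in [s ln (2en/s)]. *)
Lemma sum_ln_ge (s : nat) : s%:R * ln s%:R - s%:R <= \sum_(j < s) ln j.+1%:R :> R.
Proof.
elim: s => [|s IH]; first by rewrite big_ord0 mul0r subr0.
rewrite big_ord_recr/=.
case: s IH => [_|s IH]; first by rewrite big_ord0 ln1 mulr0 !add0r oppr_le0.
have sR : 0 < s.+1%:R :> R by rewrite ltr0n.
have h : ln s.+2%:R <= ln s.+1%:R + s.+1%:R^-1 :> R.
  rewrite (_ : s.+2%:R = s.+1%:R * (1 + s.+1%:R^-1)); last first.
    by rewrite mulrDr mulr1 mulfV ?gt_eqF// -natr1.
  rewrite lnM ?posrE// ?addr_gt0 ?invr_gt0// lerD2l.
  by apply: le_ln1Dx; rewrite (lt_le_trans _ (ltW (_ : 0 < s.+1%:R^-1))) ?ltrN10 ?invr_gt0.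
have : s.+1%:R * ln s.+2%:R <= s.+1%:R * ln s.+1%:R + 1 :> R.
  apply: le_trans (ler_wpM2l (ltW sR) h) _.
  by rewrite mulrDr mulfV ?gt_eqF.
rewrite -[s.+2%:R]natr1; move: (ln (_ + 1)) (ln s.+1%:R) IH => x y; lra.
Qed.

Lemma sum_lam_seq_sqr_le (s : nat) : (0 < s)%N -> (s <= n)%N ->
  \sum_(j < s) lam_seq sigma n j.+1 ^+ 2 <=
  sigma ^+ 2 * (s%:R * ln (2 * expR 1 * n%:R / s%:R)).
Proof.
move=> s0 sn.
have nR : 0 < n%:R :> R by rewrite ltr0n.
have sR : 0 < s%:R :> R by rewrite ltr0n.
rewrite (eq_bigr (fun j : 'I_s => sigma ^+ 2 * (ln (2 * n%:R) - ln j.+1%:R))); last first.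
  move=> j _; rewrite lam_seq_sqr//; last exact: leq_trans sn.
  by rewrite ln_div ?posrE ?mulr_gt0 ?ltr0n.
rewrite -mulr_sumr ler_wpM2l ?sqr_ge0// sumrB sumr_const card_ord.
rewrite (_ : 2 * expR 1 * n%:R = 2 * n%:R * expR 1); last by ring.
rewrite ln_div ?posrE ?mulr_gt0 ?expR_gt0// [ln (_ * expR 1)]lnM ?posrE ?mulr_gt0 ?expR_gt0// expRK.
by have := sum_ln_ge s; rewrite -[_ *+ s]mulr_natl; lra.
Qed.
End lam.

Lemma sum_ord_lt (R : realType) (n s : nat) (F : nat -> R) : (s <= n)%N ->
  \sum_(j < n | (j < s)%N) F j = \sum_(j < s) F j.
Proof. by move=> sn; rewrite (big_ord_widen n). Qed.

(** * Control of the noise by the sorted norm *)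

Section noise.
Context {R : realType}.
Variables (sigma : R) (n s : nat).
Hypotheses (sigma_gt0 : 0 < sigma) (s_gt0 : (0 < s)%N) (sn : (s <= n)%N).
Let lam (j : 'I_n) := lam_seq sigma n j.+1.
Let Lam : R := Num.sqrt (\sum_(j < s) lam_seq sigma n j.+1 ^+ 2).
Let n_gt0 : (0 < n)%N := leq_trans s_gt0 sn.

Lemma lam_mono (i j : 'I_n) : (i <= j)%N -> lam j <= lam i.
Proof. by move=> ij; exact: lam_seq_mono. Qed.

Lemma lam_ge0 (i : 'I_n) : 0 <= lam i.
Proof. exact: lam_seq_ge0. Qed.

Lemma sorted_abs_sqr_le (m : 'cV[R]_n) :
  \sum_(j < n | (j < s)%N) sorted_abs m j ^+ 2 <= sqnorm m.
Proof.
have [f fi fE] := sorted_abs_perm m.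
rewrite /sqnorm [leRHS](reindex_inj fi)/= [leRHS](bigID (fun j : 'I_n => (j < s)%N))/=.
rewrite [leLHS](eq_bigr (fun j => m (f j) 0 ^+ 2)).
  by rewrite lerDl; apply: sumr_ge0 => j _; exact: sqr_ge0.
by move=> j _; rewrite fE real_normK ?num_real.
Qed.

Lemma head_le (m : 'cV[R]_n) :
  \sum_(j < n | (j < s)%N) lam j * sorted_abs m j <= Lam * Num.sqrt (sqnorm m).
Proof.
rewrite /Lam -sqrtrM; last by apply: sumr_ge0 => j _; exact: sqr_ge0.
rewrite -[leLHS]ger0_norm; last first.
  by apply: sumr_ge0 => j _; rewrite mulr_ge0 ?lam_ge0// sorted_abs_ge0.
rewrite -sqrtr_sqr ler_wsqrtr//.
apply: le_trans (cauchy_schwarz_sum _ _ _) _.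
rewrite (sum_ord_lt (fun j => lam_seq sigma n j.+1 ^+ 2) sn).
rewrite ler_wpM2l//; first by apply: sumr_ge0 => j _; exact: sqr_ge0.
exact: sorted_abs_sqr_le.
Qed.

Lemma card_image_lt (f : 'I_n -> 'I_n) (k : nat) : injective f -> (k <= n)%N ->
  #|f @: [set i : 'I_n | (i < k)%N]%SET| = k.
Proof.
move=> fi kn; rewrite card_imset// -sum1dep_card -(big_ord_widen n (fun=> 1%N))//.
by rewrite sum1_card card_ord.
Qed.

Variable e : 'cV[R]_n.
Hypothesis He : forall S : {set 'I_n}, (s <= #|S|)%N ->
  \sum_(i in S) e i 0 ^+ 2 <= 24 * sigma ^+ 2 * (#|S|%:R * ln (2 * n%:R / #|S|%:R)).

Lemma top_sqr_le (f : 'I_n -> 'I_n) (k : nat) : injective f -> (s <= k)%N -> (k <= n)%N ->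
  \sum_(i < n | (i < k)%N) `|e (f i) 0| ^+ 2 <= 24 * (k%:R * lam_seq sigma n k ^+ 2).
Proof.
move=> fi sk kn.
have := He (S := f @: [set i : 'I_n | (i < k)%N]%SET).
rewrite card_image_lt// => /(_ sk).
rewrite big_imset/=; last by move=> i j _ _; exact: fi.
rewrite lam_seq_sqr ?(leq_trans s_gt0)// => h.
rewrite (_ : 24 * _ = 24 * sigma ^+ 2 * (k%:R * ln (2 * n%:R / k%:R))); last by ring.
apply: le_trans h; rewrite le_eqVlt; apply/orP; left; apply/eqP.
by apply: eq_big => [i|i _]; rewrite ?inE// real_normK ?num_real.
Qed.

(** Indices are listed by decreasing [|m_i|]. The first [s] are treated by Cauchy-Schwarz with
    [24 s lambda_s^2 <= 24 Lam^2], the others by summation by parts, comparing partial sums of [|e|]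
    with those of [c lam]. *)
Lemma noise_dot_le (c : R) (m : 'cV[R]_n) : 0 <= c -> 24 <= c ^+ 2 ->
  dotv e m <= c * (Lam * Num.sqrt (sqnorm m) + Jsl lam m).
Proof.
move=> c0 c24; have [f fi fE] := sorted_abs_perm m.
have -> : dotv e m = \sum_j e (f j) 0 * m (f j) 0 by rewrite /dotv (reindex_inj fi).
apply: (@le_trans _ _ (\sum_j `|e (f j) 0| * sorted_abs m j)).
  by apply: ler_sum => j _; rewrite fE -normrM ler_norm.
rewrite (bigID (fun j : 'I_n => (j < s)%N))/= mulrDr; apply: lerD.
  rewrite /Lam -sqrtrM; last by apply: sumr_ge0 => j _; exact: sqr_ge0.
  rewrite -[c]ger0_norm// -sqrtr_sqr -sqrtrM ?sqr_ge0//.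
  rewrite -[leLHS]ger0_norm; last first.
    by apply: sumr_ge0 => j _; rewrite mulr_ge0// sorted_abs_ge0.
  rewrite -sqrtr_sqr ler_wsqrtr//.
  apply: le_trans (cauchy_schwarz_sum _ _ _) _; rewrite mulrA ler_pM//.
  - by apply: sumr_ge0 => j _; exact: sqr_ge0.
  - by apply: sumr_ge0 => j _; exact: sqr_ge0.
  - apply: le_trans (top_sqr_le fi (leqnn s) sn) _.
    apply: ler_pM => //; first by rewrite mulr_ge0// sqr_ge0.
    rewrite mulr_natl -[X in _ *+ X]card_ord -sumr_const.
    apply: ler_sum => j _; rewrite lerXn2r ?nnegrE ?lam_seq_ge0//.
    exact: lam_seq_mono.
  - exact: sorted_abs_sqr_le.
(* With the head set to 0, partial sums up to [k <= s] vanish. For [k > s], Cauchy-Schwarz against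
   the constant 1 gives at most [c k lambda_k], which is below the partial sum of [c lam]. *)
pose a (j : 'I_n) : R := if (j < s)%N then 0 else `|e (f j) 0|.
rewrite (_ : \sum_(j | _) _ = \sum_(j < n) sorted_abs m j * a j); last first.
  rewrite big_mkcond; apply: eq_bigr => j _.
  by rewrite /a; case: (j < s)%N; rewrite /= ?mulr0// mulrC.
rewrite (_ : c * Jsl lam m = \sum_(j < n) sorted_abs m j * (c * lam j)); last first.
  by rewrite /Jsl mulr_sumr; apply: eq_bigr => j _; ring.
apply: abel_sum_le => [i j ij|j|k kn]; [exact: sorted_abs_mono|exact: sorted_abs_ge0|].
have b0 (j : 'I_n) : 0 <= c * lam j by rewrite mulr_ge0 ?lam_ge0.
have [ks|sk] := leqP k s.
  rewrite big1; first by apply: sumr_ge0.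
  by move=> j jk; rewrite /a (leq_trans jk ks).
apply: (@le_trans _ _ (\sum_(i < n | (i < k)%N) `|e (f i) 0| * 1)).
  by apply: ler_sum => i _; rewrite /a mulr1; case: ifP.
apply: (@le_trans _ _ (c * (k%:R * lam_seq sigma n k))); last first.
  rewrite -mulr_sumr ler_wpM2l// (sum_ord_lt (fun j => lam_seq sigma n j.+1) kn).
  rewrite mulr_natl -[X in _ *+ X]card_ord -sumr_const.
  by apply: ler_sum => j _; exact: lam_seq_mono.
rewrite -(@ler_pXn2r _ 2)// ?nnegrE; last 2 first.
- by apply: sumr_ge0 => i _; rewrite mulr1.
- by rewrite mulr_ge0// mulr_ge0// lam_seq_ge0.
apply: le_trans (cauchy_schwarz_sum _ _ _) _.
under [X in _ * X <= _]eq_bigr do rewrite expr1n.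
rewrite (sum_ord_lt (fun=> 1) kn) sumr_const card_ord.
have := top_sqr_le fi (ltnW sk) kn.
move: (\sum_(i | _) _) (lam_seq_ge0 n sigma_gt0 k) => x.
move: (lam_seq _ _ _) (ler0n R k) => l; move: (k%:R : R) => K K0 l0 h.
apply: (@le_trans _ _ (24 * (K * l ^+ 2) * K)); first exact: ler_wpM2r.
rewrite (_ : (c * (K * l)) ^+ 2 = c ^+ 2 * (K * l ^+ 2) * K); last by ring.
by rewrite ler_wpM2r// ler_wpM2r// mulr_ge0// sqr_ge0.
Qed.
End noise.

(** * The estimation error *)

Section bilinear.
Context {R : realType} {n : nat}.
Implicit Types u v : 'cV[R]_n.

Lemma dotvC u v : dotv u v = dotv v u.
Proof. by apply: eq_bigr => i _; rewrite mulrC. Qed.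

Lemma dotvDr u v w : dotv u (v + w) = dotv u v + dotv u w.
Proof. by rewrite -big_split; apply: eq_bigr => i _; rewrite mxE mulrDr. Qed.

Lemma dotvBr u v w : dotv u (v - w) = dotv u v - dotv u w.
Proof. by rewrite /dotv -sumrB; apply: eq_bigr => i _; rewrite !mxE mulrBr. Qed.

Lemma dotvZr (t : R) u v : dotv u (t *: v) = t * dotv u v.
Proof. by rewrite mulr_sumr; apply: eq_bigr => i _; rewrite mxE mulrCA. Qed.

Lemma dotv0r u : dotv u 0 = 0.
Proof. by rewrite /dotv big1// => i _; rewrite mxE mulr0. Qed.

Lemma dotvv u : dotv u u = sqnorm u.
Proof. by apply: eq_bigr => i _; rewrite expr2. Qed.

Lemma sqnormZ (t : R) u : sqnorm (t *: u) = t ^+ 2 * sqnorm u.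
Proof. by rewrite mulr_sumr; apply: eq_bigr => i _; rewrite mxE exprMn. Qed.

Lemma sqnormD u v : sqnorm (u + v) = sqnorm u + 2 * dotv u v + sqnorm v.
Proof.
rewrite mulr_sumr -!big_split; apply: eq_bigr => i _; rewrite mxE /=; ring.
Qed.

Lemma sqnorm0 : sqnorm (0 : 'cV[R]_n) = 0.
Proof. by apply/eqP; rewrite sqnorm_eq0. Qed.
End bilinear.

Lemma ge0_of_small_slope (R : realType) (A B : R) : 0 <= B ->
  (forall t, 0 < t -> t <= 1 -> 0 <= A + t * B) -> 0 <= A.
Proof.
move=> B0 h; rewrite leNgt; apply/negP => A0.
have BA : 0 < B - A by lra.
(* At this [t] the affine function equals [- A^2 / (B - A)], and [B >= 0] ensures [t <= 1]. *)
have := h (- A / (B - A)); rewrite divr_gt0 ?oppr_gt0// ler_pdivrMr// mul1r.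
move=> /(_ isT) /(_ _); rewrite (_ : A + _ = - (A ^+ 2 / (B - A))); last by field; rewrite gt_eqF.
rewrite oppr_ge0 => /(_ _) H; have : A ^+ 2 / (B - A) <= 0 by apply: H; lra.
by rewrite leNgt divr_gt0// exprn_even_gt0//= lt_eqF.
Qed.

(** * First-order conditions at a minimiser *)

Section argmin.
Context {R : realType} {n p : nat}.
Variables (X : 'M[R]_(n, p)) (beta : 'cV[R]_p) (mu e : 'cV[R]_n) (rho : R) (lam : 'I_n -> R).
Variables (bh : 'cV[R]_p) (mh : 'cV[R]_n).
Hypothesis lam_mono : forall i j : 'I_n, (i <= j)%N -> lam j <= lam i.
Hypothesis lam0 : forall i, 0 <= lam i.
Hypothesis rho0 : 0 <= rho.
Hypothesis Hmin : is_argmin X (X *m beta + mu + e) rho lam bh mh.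

Let b := bh - beta.
Let m := mh - mu.
Let r := X *m b + m.

Let residual (t : R) : X *m beta + mu + e - X *m (bh - t *: b) - (mh - t *: m) =
  (e - r) + t *: r.
Proof.
rewrite /r /b /m !mulmxBr -scalemxAr mulmxBr.
by apply/colP => i; rewrite !mxE; ring.
Qed.

Let residual0 : X *m beta + mu + e - X *m bh - mh = e - r.
Proof. by have := residual 0; rewrite !scale0r !subr0 addr0. Qed.

Let residualb (t : R) : X *m beta + mu + e - X *m (bh - t *: b) - mh = (e - r) + t *: (X *m b).
Proof.
rewrite /r /b /m !mulmxBr -scalemxAr mulmxBr.
by apply/colP => i; rewrite !mxE; ring.
Qed.

(** Moving by a small [t] towards the truth, rather than comparing directly with it, gains a factor
    2 on the noise and penalty terms. *)
Lemma argmin_basic_inequality : sqnorm r <= dotv e r + rho * (Jsl lam mu - Jsl lam mh).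
Proof.
have : 0 <= 2 * dotv (e - r) r + 2 * rho * (Jsl lam mu - Jsl lam mh).
  apply: (ge0_of_small_slope (sqnorm_ge0 r)) => t t0 t1.
  have := Hmin (bh - t *: b) (mh - t *: m).
  rewrite /objective residual residual0 [sqnorm (_ + t *: _)]sqnormD dotvZr sqnormZ => h.
  have J : Jsl lam (mh - t *: m) <= (1 - t) * Jsl lam mh + t * Jsl lam mu.
    have -> : mh - t *: m = (1 - t) *: mh + t *: mu.
      by apply/colP => i; rewrite !mxE; ring.
    by apply: Jsl_convex => //; rewrite ltW.
  have := ler_wpM2l rho0 J => J'.
  rewrite -(pmulr_rge0 _ t0); nra.
by rewrite dotvC dotvBr dotvv [dotv r e]dotvC; lra.
Qed.

(** The direction [b] is unpenalised and both signs of [t] are allowed, so the derivative along it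
    is zero. *)
Lemma argmin_normal_equation : dotv e (X *m b) = sqnorm (X *m b) + dotv (X *m b) m.
Proof.
have q t : 0 <= 2 * t * dotv (e - r) (X *m b) + t ^+ 2 * sqnorm (X *m b).
  have := Hmin (bh - t *: b) mh.
  by rewrite /objective residualb residual0 [sqnorm (_ + t *: _)]sqnormD dotvZr sqnormZ; lra.
have D0 : 0 <= 2 * dotv (e - r) (X *m b).
  apply: (ge0_of_small_slope (sqnorm_ge0 (X *m b))) => t t0 t1.
  by rewrite -(pmulr_rge0 _ t0); have := q t; nra.
have D1 : 0 <= - (2 * dotv (e - r) (X *m b)).
  apply: (ge0_of_small_slope (sqnorm_ge0 (X *m b))) => t t0 t1.
  by rewrite -(pmulr_rge0 _ t0); have := q (- t); nra.
have : dotv (e - r) (X *m b) = 0 by apply/eqP; rewrite eq_le; apply/andP; split; lra.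
by rewrite dotvC dotvBr /r dotvDr dotvv dotvC; lra.
Qed.
End argmin.

(* With [a = |Xb|], [M = |m|] and [z = <Xb, m>]: as [a^2 <= q a - z], the fitted part satisfies
   [a <= q + M]. *)
Lemma normal_equation_bound (R : realType) (a M z q x : R) : 0 <= a -> 0 <= M -> 0 <= q ->
  `|z| <= a * M -> x <= q * a -> x = a ^+ 2 + z -> - (q * M) <= M ^+ 2 + z.
Proof.
move=> a0 M0 q0; rewrite ler_norml => /andP[zl zu] xq xE.
have : a <= q + M.
  rewrite leNgt; apply/negP => h.
  have : a * (q + M) < a * a by rewrite ltr_pM2l//; lra.
  by nra.
by move=> h; nra.
Qed.

(** From [k1 <= 1], [k1 D <= T], hence [k T <= k1 (T - 2 k2 D) <= k1 (q a + c M)]. Cauchy-Schwarz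
    gives [k^2 T <= k1^2 K]; returning to [D] costs one factor [k1], and the other is at most 1. *)
Lemma quadratic_error_bound (R : realType) (k1 k2 b2 a M z q c : R) :
  0 < k2 -> 2 * k2 < k1 -> k1 <= 1 -> 0 <= b2 -> 0 <= a -> 0 <= M -> 0 <= q -> 0 <= c ->
  k1 * b2 <= a ^+ 2 -> `|z| <= k2 * (b2 + M ^+ 2) ->
  a ^+ 2 + 2 * z + M ^+ 2 <= q * a + c * M ->
  b2 + M ^+ 2 <= (q ^+ 2 + c ^+ 2) / (k1 - 2 * k2) ^+ 2.
Proof.
move=> k20 k12 k11 b20 a0 M0 q0 c0 ha; rewrite ler_norml => /andP[zl _] h.
set k := k1 - 2 * k2; have k0 : 0 < k by rewrite /k; lra.
set K := q ^+ 2 + c ^+ 2; set D := b2 + M ^+ 2; set T := a ^+ 2 + M ^+ 2.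
have K0 : 0 <= K by rewrite addr_ge0// sqr_ge0.
have D0 : 0 <= D by rewrite addr_ge0// sqr_ge0.
have T0 : 0 <= T by rewrite addr_ge0// sqr_ge0.
have TD : k1 * D <= T by rewrite /T /D; have := sqr_ge0 M; nra.
have h1 : T - 2 * (k2 * D) <= q * a + c * M.
  by move: zl; rewrite -/D /T; move: (k2 * D) => y zl; lra.
have h2 : k * T <= k1 * (q * a + c * M).
  apply: (@le_trans _ _ (k1 * (T - 2 * (k2 * D)))).
    by rewrite /k; nra.
  by rewrite ler_wpM2l//; lra.
have h3 : (q * a + c * M) ^+ 2 <= K * T.
  by have := sqr_ge0 (q * M - c * a); rewrite /K /T; nra.
have h4 : (k * T) ^+ 2 <= k1 ^+ 2 * (K * T).
  apply: (@le_trans _ _ ((k1 * (q * a + c * M)) ^+ 2)).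
    rewrite lerXn2r// nnegrE mulr_ge0//; [exact: ltW|lra|].
    by rewrite addr_ge0// mulr_ge0.
  by rewrite exprMn ler_wpM2l// sqr_ge0.
have h5 : k ^+ 2 * T <= k1 ^+ 2 * K.
  move: T0; rewrite le_eqVlt => /predU1P[<-|T0]; first by rewrite mulr0 mulr_ge0// sqr_ge0.
  by rewrite -(ler_pM2r T0); move: h4; rewrite exprMn; nra.
rewrite ler_pdivlMr ?exprn_gt0//.
have k10 : 0 < k1 by lra.
have h6 : k1 * (D * k ^+ 2) <= k1 * (k1 * K).
  apply: (@le_trans _ _ (k ^+ 2 * T)); last by move: h5; rewrite expr2; nra.
  by rewrite mulrA mulrC ler_wpM2l// sqr_ge0.
move: h6; rewrite ler_pM2l// => h6; apply: le_trans h6 _.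
by rewrite ler_piMl.
Qed.

(** Here [l] and [q] are the levels [Lam] and [sigma sqrt(5p)] times [|m|], while [x] and [y] are
    [lamn sqrt k1] and [lamn sqrt s1] times [|m|]. *)
Lemma cone_arithmetic (R : realType) (head tail x y l q : R) : 0 <= x ->
  tail <= 4 * l + 1 / 5 * q -> head <= l -> q <= 3 * x -> l <= y ->
  head + tail <= 5 * x + 5 * y.
Proof. by intros; lra. Qed.

(** * Consequences of the cone condition and the deterministic error bound *)

Section restricted_eigenvalue.
Context {R : realType}.
Variables (n p s : nat) (X : 'M[R]_(n, p)) (sigma kappa1 kappa2 : R).
Hypotheses (s_gt0 : (0 < s)%N) (sn : (s <= n)%N) (sigma_gt0 : 0 < sigma).
Let lam := fun j : 'I_n => lam_seq sigma n j.+1.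
Let k1 : R := p%:R / ln 2.
Let s1 : R := s%:R * ln (2 * expR 1 * n%:R / s%:R) / ln 2.
Let Lam : R := Num.sqrt (\sum_(j < s) lam_seq sigma n j.+1 ^+ 2).
Let lamn := lam_seq sigma n n.
Let n_gt0 : (0 < n)%N := leq_trans s_gt0 sn.

Let ln2_gt0 : 0 < ln 2 :> R. Proof. by rewrite ln_gt0// ltr1n. Qed.

Let lamn_sqr : lamn ^+ 2 = sigma ^+ 2 * ln 2.
Proof. by rewrite lam_seq_sqr// mulfK// pnatr_eq0 -lt0n. Qed.

Let lamn_gt0 : 0 < lamn.
Proof.
rewrite lt_neqAle lam_seq_ge0// andbT eq_sym -sqrf_eq0 lamn_sqr.
by rewrite gt_eqF// mulr_gt0// exprn_gt0.
Qed.

(** As [lamn^2 = sigma^2 ln 2], the [ln 2] in [s1] cancels. This and [design_level_le], where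
    [5 <= 9], express the noise levels in the units of the cone. *)
Lemma Lam_le_lamn : Lam <= lamn * Num.sqrt s1.
Proof.
rewrite -[lamn]gtr0_norm// -sqrtr_sqr -sqrtrM ?sqr_ge0// ler_wsqrtr//.
apply: le_trans (sum_lam_seq_sqr_le sigma_gt0 n_gt0 s_gt0 sn) _.
rewrite lamn_sqr /s1; move: (ln (_ / _)) => x.
by rewrite le_eqVlt; apply/orP; left; apply/eqP; field; rewrite gt_eqF.
Qed.

Lemma design_level_le : sigma * Num.sqrt (5 * p%:R) <= 3 * (lamn * Num.sqrt k1).
Proof.
have k10 : 0 <= k1 by rewrite divr_ge0// ltW.
have sg0 := ltW sigma_gt0; have ln0 := ltW lamn_gt0.
rewrite -(@ler_pXn2r _ 2)// ?nnegrE ?mulr_ge0//.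
rewrite exprMn [(3 * _) ^+ 2]exprMn [(lamn * _) ^+ 2]exprMn lamn_sqr.
rewrite (sqr_sqrtr k10) sqr_sqrtr ?mulr_ge0// /k1.
rewrite (_ : sigma ^+ 2 * ln 2 * (p%:R / ln 2) = sigma ^+ 2 * p%:R); last first.
  by field; rewrite gt_eqF.
have : 0 <= sigma ^+ 2 * p%:R by rewrite mulr_ge0// sqr_ge0.
by rewrite [sigma ^+ 2 * (5 * _)]mulrCA; move: (_ * p%:R) => x; lra.
Qed.

Hypothesis kappa2_gt0 : 0 < kappa2.
Hypothesis RE : forall (b : 'cV[R]_p) (m : 'cV[R]_n),
     \sum_(j < n) (lam j / lamn) * sorted_abs m j
       <= 5 * (Num.sqrt k1 * Num.sqrt (sqnorm b) + Num.sqrt s1 * Num.sqrt (sqnorm m)) ->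
     sqnorm (X *m b) + sqnorm m >= kappa1 * (sqnorm b + sqnorm m) /\
     `|dotv (X *m b) m| <= kappa2 * (sqnorm b + sqnorm m).

Let lam_mono (i j : 'I_n) : (i <= j)%N -> lam j <= lam i.
Proof. by move=> ij; exact: lam_seq_mono. Qed.

Let lam_ge0 (i : 'I_n) : 0 <= lam i.
Proof. exact: lam_seq_ge0. Qed.

Lemma RE_Jsl (b : 'cV[R]_p) (m : 'cV[R]_n) :
     Jsl lam m <= lamn * (5 * (Num.sqrt k1 * Num.sqrt (sqnorm b) +
       Num.sqrt s1 * Num.sqrt (sqnorm m))) ->
     sqnorm (X *m b) + sqnorm m >= kappa1 * (sqnorm b + sqnorm m) /\
     `|dotv (X *m b) m| <= kappa2 * (sqnorm b + sqnorm m).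
Proof.
move=> h; apply: RE; rewrite (_ : \sum_j _ = Jsl lam m / lamn); last first.
  by rewrite /Jsl mulr_suml; apply: eq_bigr => j _; ring.
by rewrite ler_pdivrMr// mulrC.
Qed.

Lemma RE_design (b : 'cV[R]_p) : kappa1 * sqnorm b <= sqnorm (X *m b).
Proof.
have [] := @RE_Jsl b 0; last by rewrite sqnorm0 !addr0.
rewrite Jsl0 !mulr_ge0// ?addr_ge0 ?mulr_ge0//; exact: ltW.
Qed.

Lemma RE_kappa1_le1 : kappa1 <= 1.
Proof.
pose i0 : 'I_n := Ordinal n_gt0.
pose m : 'cV[R]_n := delta_mx i0 0.
have m1 : sqnorm m = 1.
  rewrite /sqnorm (bigD1 i0)//= big1 ?addr0; first by rewrite mxE !eqxx expr1n.
  by move=> i /negPf ii0; rewrite mxE ii0 expr0n.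
have [] := @RE_Jsl 0 m; last by rewrite mulmx0 !sqnorm0 !add0r m1 mulr1.
have ml0 : (l0 m <= s)%N.
  apply: leq_trans s_gt0; rewrite -(card1 i0) /l0; apply: subset_leq_card.
  apply/fintype.subsetP => i /set_mem /=; rewrite mxE !inE.
  by case: (i == i0); rewrite //= eqxx.
(* Perturbing the sparse [m] by [- m] gives zero, so the inequality bounds [Jsl lam m] itself
   without computing its sorted entries. *)
have := Jsl_sparse_sub_le lam_mono lam_ge0 (- m) ml0.
rewrite subrr Jsl0 subr0 => h; apply: (le_trans h).
have t0 : 0 <= \sum_(j < n | ~~ (j < s)%N) lam j * sorted_abs (- m) j.
  by apply: sumr_ge0 => j _; rewrite mulr_ge0// sorted_abs_ge0.
have sN : sqnorm (- m) = 1 by rewrite -scaleN1r sqnormZ sqrrN expr1n mul1r.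
have hl : \sum_(j < n | (j < s)%N) lam j * sorted_abs (- m) j <= Lam.
  by have := head_le sigma_gt0 sn (- m); rewrite sN sqrtr1 mulr1.
rewrite sqnorm0 sqrtr0 mulr0 add0r m1 sqrtr1 mulr1 [lamn * _]mulrCA.
have := Lam_le_lamn; have : 0 <= lamn * Num.sqrt s1 by rewrite mulr_ge0// ltW.
by move: (lamn * _) (\sum_(j | _) _) (\sum_(j | _) _) t0 hl => x y z; lra.
Qed.

(* The cone condition only sees [|b|]: it holds for [(t b, m)] with [t |b| = |m|], and the bound
   on [<X b, m>] rescales.  The pair [(b, m)] itself need not belong to the cone. *)
Lemma RE_cross (b : 'cV[R]_p) (m : 'cV[R]_n) :
  Jsl lam m <= lamn * (5 * ((Num.sqrt k1 + Num.sqrt s1) * Num.sqrt (sqnorm m))) ->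
  `|dotv (X *m b) m| <= kappa2 * (sqnorm b + sqnorm m).
Proof.
move=> h.
have rhs0 : 0 <= kappa2 * (sqnorm b + sqnorm m).
  by rewrite mulr_ge0 ?addr_ge0 ?sqnorm_ge0// ltW.
have [->|b0] := eqVneq b 0.
  rewrite mulmx0 dotvC dotv0r normr0 mulr_ge0 ?addr_ge0 ?sqnorm_ge0//.
  exact: ltW.
have [m0|m0] := eqVneq m 0; first by rewrite {1}m0 dotv0r normr0.
have nb : 0 < Num.sqrt (sqnorm b).
  by rewrite sqrtr_gt0 lt_neqAle sqnorm_ge0 eq_sym sqnorm_eq0 b0.
have nm : 0 < Num.sqrt (sqnorm m).
  by rewrite sqrtr_gt0 lt_neqAle sqnorm_ge0 eq_sym sqnorm_eq0 m0.
pose t := Num.sqrt (sqnorm m) / Num.sqrt (sqnorm b).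
have t0 : 0 < t by rewrite divr_gt0.
have tb : sqnorm (t *: b) = sqnorm m.
  rewrite sqnormZ /t exprMn exprVn !sqr_sqrtr ?sqnorm_ge0// mulfVK//.
  by rewrite sqnorm_eq0.
have /RE_Jsl[_] : Jsl lam m <= lamn * (5 * (Num.sqrt k1 * Num.sqrt (sqnorm (t *: b)) +
    Num.sqrt s1 * Num.sqrt (sqnorm m))) by rewrite tb -mulrDl.
rewrite tb -scalemxAr dotvC dotvZr normrM gtr0_norm// dotvC.
move: (sqr_sqrtr (sqnorm_ge0 b)) (sqr_sqrtr (sqnorm_ge0 m)).
rewrite /t; move: (Num.sqrt (sqnorm b)) (Num.sqrt (sqnorm m)) nb nm => B M B0 M0 <- <-.
move: `|_| => z h'.
(* Undoing the scaling leaves [2 kappa2 |m| |b|], to which the arithmetic-geometric inequality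
   applies. *)
have {h'} : z <= kappa2 * (2 * (M * B)).
  rewrite -(ler_pM2l M0) -(ler_pM2r (_ : 0 < B^-1)) ?invr_gt0//.
  apply: le_trans (le_trans h' _); rewrite le_eqVlt; apply/orP; left; apply/eqP.
    by field; rewrite gt_eqF.
  by field; rewrite gt_eqF.
move=> h'; apply: (le_trans h'); rewrite ler_wpM2l//; first exact: ltW.
by have := sqr_ge0 (B - M); nra.
Qed.

Variables (beta : 'cV[R]_p) (mu e : 'cV[R]_n) (rho : R).
Hypothesis kappa12 : 2 * kappa2 < kappa1.
Hypothesis mu_sparse : (l0 mu <= s)%N.
Hypothesis rho_ge : 10 <= rho.
Hypothesis He_subsets : forall S : {set 'I_n}, (s <= #|S|)%N ->
  \sum_(i in S) e i 0 ^+ 2 <= 24 * sigma ^+ 2 * (#|S|%:R * ln (2 * n%:R / #|S|%:R)).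
Hypothesis He_design : forall b : 'cV[R]_p,
  `|dotv e (X *m b)| <= sigma * Num.sqrt (5 * p%:R) * Num.sqrt (sqnorm (X *m b)).

Lemma estimation_error_le (bh : 'cV[R]_p) (mh : 'cV[R]_n) :
  is_argmin X (X *m beta + mu + e) rho lam bh mh ->
  sqnorm (bh - beta) + sqnorm (mh - mu) <=
  (5 * sigma ^+ 2 * p%:R + 4 * rho ^+ 2 * \sum_(j < s) lam_seq sigma n j.+1 ^+ 2) /
  (kappa1 - 2 * kappa2) ^+ 2.
Proof.
move: rho_ge => rge Hmin; have rho0 : 0 <= rho by lra.
have := argmin_basic_inequality lam_mono lam_ge0 rho0 Hmin.
have := argmin_normal_equation Hmin.
set b := bh - beta; set m := mh - mu.
have mhE : mh = mu + m by rewrite /m addrC subrK.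
have := Jsl_sparse_sub_le lam_mono lam_ge0 m mu_sparse; rewrite -mhE.
(* [rho >= 10] makes [(rho / 2)^2 >= 25], above the required 24. *)
have := noise_dot_le sigma_gt0 s_gt0 sn He_subsets m (c := rho / 2).
have : \sum_(j < n | (j < s)%N) lam j * sorted_abs m j <= Lam * Num.sqrt (sqnorm m).
  exact: head_le.
have JE : Jsl lam m = \sum_(j < n | (j < s)%N) lam j * sorted_abs m j +
    \sum_(j < n | ~~ (j < s)%N) lam j * sorted_abs m j.
  by rewrite /Jsl (bigID (fun j : 'I_n => (j < s)%N)).
have tail0 : 0 <= \sum_(j < n | ~~ (j < s)%N) lam j * sorted_abs m j.
  by apply: sumr_ge0 => j _; rewrite mulr_ge0// sorted_abs_ge0.
rewrite -/Lam -/lam JE; move: JE tail0.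
move: (\sum_(j < n | (j < s)%N) _) (\sum_(j < n | ~~ (j < s)%N) _) => head tail.
move=> JE tail0 head_le noise pen normal basic.
have {}noise : dotv e m <= rho / 2 * (Lam * Num.sqrt (sqnorm m) + (head + tail)).
  by apply: noise; nra.
have pen' := ler_wpM2l rho0 pen.
rewrite dotvDr sqnormD in basic.
have M0 := sqrtr_ge0 (sqnorm m); have a0 := sqrtr_ge0 (sqnorm (X *m b)).
have q0 : 0 <= sigma * Num.sqrt (5 * p%:R) by rewrite mulr_ge0// ltW.
have L0 : 0 <= Lam by exact: sqrtr_ge0.
(* Noise and penalty add to [3/2 rho head - rho/2 tail + rho/2 Lam M]; then [head <= Lam M]. *)
have key : sqnorm (X *m b) + 2 * dotv (X *m b) m + sqnorm m <=
    dotv e (X *m b) + 2 * rho * Lam * Num.sqrt (sqnorm m) - rho / 2 * tail.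
  have := ler_wpM2l rho0 head_le.
  move: noise basic pen'; move: (dotv e m) (dotv e (X *m b)) (sqnorm _ + _ + _) => x y z.
  move: (Num.sqrt _) (Jsl _ _) (Jsl _ _) => M J1 J2; nra.
have dz := dotv_le_norm (X *m b) m.
have dx := le_trans (ler_norm _) (He_design b).
have M2 := sqr_sqrtr (sqnorm_ge0 m); have a2 := sqr_sqrtr (sqnorm_ge0 (X *m b)).
have neb := normal_equation_bound a0 M0 q0 dz dx.
rewrite a2 normal in neb; have {}neb := neb erefl; rewrite M2 in neb.
have cross : `|dotv (X *m b) m| <= kappa2 * (sqnorm b + sqnorm m).
  apply: RE_cross; rewrite JE.
  have := ler_wpM2r M0 Lam_le_lamn; have := ler_wpM2r M0 design_level_le.
  (* In [key] the normal equation cancels [|X b|^2 + <X b, m>]; since the remaining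
     [|m|^2 + <X b, m>] is at least [- q M], dividing by [rho / 2 >= 5] bounds [tail]. *)
  have t1 : tail <= 4 * (Lam * Num.sqrt (sqnorm m)) +
      1 / 5 * (sigma * Num.sqrt (5 * p%:R) * Num.sqrt (sqnorm m)).
    have qM0 : 0 <= sigma * Num.sqrt (5 * p%:R) * Num.sqrt (sqnorm m) by rewrite mulr_ge0.
    rewrite -(ler_pM2l (_ : 0 < rho / 2)); last by lra.
    by nra.
  have w0 : 0 <= lamn * Num.sqrt k1 * Num.sqrt (sqnorm m).
    by rewrite !mulr_ge0// ltW.
  move: w0 t1 head_le.
  rewrite (_ : lamn * (5 * _) = 5 * (lamn * Num.sqrt k1 * Num.sqrt (sqnorm m)) +
     5 * (lamn * Num.sqrt s1 * Num.sqrt (sqnorm m))); last by ring.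
  rewrite -[3 * _ * _]mulrA.
  by move=> w0 t1 hl q1 l1; exact: cone_arithmetic w0 t1 hl q1 l1.
have c0 : 0 <= 2 * rho * Lam by rewrite !mulr_ge0.
have := @quadratic_error_bound R kappa1 kappa2 (sqnorm b) (Num.sqrt (sqnorm (X *m b)))
  (Num.sqrt (sqnorm m)) (dotv (X *m b) m) (sigma * Num.sqrt (5 * p%:R)) (2 * rho * Lam).
rewrite a2 M2 => h; have {}h := h kappa2_gt0 kappa12 RE_kappa1_le1 (sqnorm_ge0 b) a0 M0 q0 c0
  (RE_design b) cross.
apply: le_trans (h _) _.
  by apply: le_trans key _; have := mulr_ge0 rho0 tail0; lra.
rewrite !exprMn !sqr_sqrtr ?mulr_ge0//; last by apply: sumr_ge0 => j _; exact: sqr_ge0.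
rewrite le_eqVlt; apply/orP; left; apply/eqP; congr (_ / _).
by move: (\sum_(j < s) _) => x; ring.
Qed.
End restricted_eigenvalue.

Theorem theorem2 (R : realType) (n p s : nat) (X : 'M[R]_(n, p))
  (beta_star : 'cV[R]_p) (mu_star : 'cV[R]_n) (sigma rho kappa1 kappa2 : R)
  (d : measure_display) (Omega : measurableType d) (P : probability Omega R)
  (eps : 'I_n -> Omega -> R) :
  (forall j : 'I_p, \sum_(i < n) X i j ^+ 2 = 1) ->
  (0 < s)%N -> (s <= n)%N ->
  (l0 mu_star <= s)%N ->
  0 < sigma ->
  gaussian_noise P sigma eps ->
  2 * (4 + Num.sqrt 2) <= rho ->
  let lam := fun j : 'I_n => lam_seq sigma n j.+1 in
  let k1 := p%:R / ln 2 in
  let s1 := s%:R * ln (2 * expR 1 * n%:R / s%:R) / ln 2 in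
  0 < kappa2 -> 2 * kappa2 < kappa1 ->
  (forall (b : 'cV[R]_p) (m : 'cV[R]_n),
     \sum_(j < n) (lam j / lam_seq sigma n n) * sorted_abs m j
       <= 5 * (Num.sqrt k1 * Num.sqrt (sqnorm b) + Num.sqrt s1 * Num.sqrt (sqnorm m)) ->
     sqnorm (X *m b) + sqnorm m >= kappa1 * (sqnorm b + sqnorm m) /\
     `|dotv (X *m b) m| <= kappa2 * (sqnorm b + sqnorm m)) ->
  let kappa := Num.sqrt (kappa1 - 2 * kappa2) in
  exists A : set Omega, measurable A /\
    (P A >= (1 - 2^-1 * (s%:R / (2 * n%:R)) ^+ s - expR (- p%:R))%:E)%E /\
    forall w, A w ->
      forall (bh : 'cV[R]_p) (mh : 'cV[R]_n),
        is_argmin X (X *m beta_star + mu_star + noise_vec eps w) rho lam bh mh ->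
        sqnorm (bh - beta_star) + sqnorm (mh - mu_star)
          <= 4 * rho ^+ 2 / kappa ^+ 4 * (\sum_(j < s) lam_seq sigma n j.+1 ^+ 2)
             + 5 * sigma ^+ 2 / kappa ^+ 4 * p%:R
        /\
        4 * rho ^+ 2 / kappa ^+ 4 * (\sum_(j < s) lam_seq sigma n j.+1 ^+ 2)
             + 5 * sigma ^+ 2 / kappa ^+ 4 * p%:R
          <= sigma ^+ 2 / kappa ^+ 4 *
             (4 * rho ^+ 2 * s%:R * ln (2 * expR 1 * n%:R / s%:R) + 5 * p%:R).
Proof.
move=> _ s0 sn mus sigma0 Heps rhole lam k1 s1 k20 k12 RE kappa.
have n0 : (0 < n)%N by exact: leq_trans s0 sn.
have [B1 [mB1 PB1 HB1]] := noise_event_design Heps sigma0 X.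
have [B2 [mB2 PB2 HB2]] := noise_event_subsets Heps sigma0 s0.
exists (~` (B1 `|` B2)); split; [|split].
- by apply: measurableC; exact: measurableU.
- rewrite probability_setC; last exact: measurableU.
  have PB : (P (B1 `|` B2) <=
      (expR (- p%:R) + 2^-1 * (s%:R / (2 * n%:R)) ^+ s)%:E)%E.
    by apply: le_trans (measureU2 P mB1 mB2) _; rewrite EFinD leeD.
  rewrite [leLHS](_ : _ = (1 - (expR (- p%:R) + 2^-1 * (s%:R / (2 * n%:R)) ^+ s)%:E)%E).
    exact: leeB.
  by rewrite -EFinB; congr (_%:E); ring.
move=> w Aw bh mh Hmin.
(* The bound [sqrt 2 >= 1] already suffices. *)
have rho10 : 10 <= rho.
  apply: le_trans rhole; have : 1 <= Num.sqrt 2 :> R.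
    by rewrite -[leLHS]sqrtr1 ler_wsqrtr// ler1n.
  lra.
have kappa4 : kappa ^+ 4 = (kappa1 - 2 * kappa2) ^+ 2.
  by rewrite (_ : 4 = 2 * 2)%N// exprM sqr_sqrtr// subr_ge0 ltW.
have k4 : 0 < kappa ^+ 4 by rewrite kappa4 exprn_gt0// subr_gt0.
split.
  have : sqnorm (bh - beta_star) + sqnorm (mh - mu_star) <=
     (5 * sigma ^+ 2 * p%:R + 4 * rho ^+ 2 * \sum_(j < s) lam_seq sigma n j.+1 ^+ 2) /
     kappa ^+ 4.
    rewrite kappa4; apply: (estimation_error_le s0 sn sigma0 k20 RE k12 mus rho10 _ _ Hmin).
      move=> S sS; under eq_bigr do rewrite mxE.
      by apply: HB2 => // Bw; apply: Aw; right.
    by apply: HB1 => Bw; apply: Aw; left.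
  move/le_trans; apply; rewrite le_eqVlt; apply/orP; left; apply/eqP.
  by move: (\sum_(j < s) _) => x; ring.
(* The second inequality is deterministic: only the sum of squared weights is enlarged. *)
have := sum_lam_seq_sqr_le sigma0 n0 s0 sn.
move: (\sum_(j < s) _) (ln (_ / _)) => x l xl.
rewrite (_ : sigma ^+ 2 / kappa ^+ 4 * _ =
  4 * rho ^+ 2 / kappa ^+ 4 * (sigma ^+ 2 * (s%:R * l)) +
  5 * sigma ^+ 2 / kappa ^+ 4 * p%:R); last by ring.
by rewrite lerD2r ler_wpM2l// divr_ge0 ?(ltW k4)// mulr_ge0// sqr_ge0.
Qed.
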